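(* Let $(R,\mathfrak m)$ be a Cohen-Macaulay local ring with $\dim R=1$ and assume that $\mathrm{v}(R)=\mathrm{e}(R)>1$. Then the set $\mathcal X_R$ is totally ordered with respect to inclusion.
   Context: Local rings are Noetherian. $\mathrm{v}(R)=\mu_R(\mathfrak m)$ denotes the embedding dimension of $R$ (the minimal number of generators of $\mathfrak m$) and $\mathrm{e}(R)=\lim_{n\to\infty}\ell_R(R/\mathfrak m^n)/n$ its multiplicity. An $\mathfrak m$-primary ideal $I$ of $R$ is called an Ulrich ideal if it contains a parameter ideal $Q=(a)$ of $R$ as a reduction and satisfies: (1) $I\neq Q$, (2) $I^2=QI$, and (3) $I/I^2$ is a free $R/I$-module. $\mathcal X_R$ denotes the set of all Ulrich ideals of $R$. *)

(* Defs.v *)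
From HB Require Import structures.
From mathcomp Require Import all_boot all_order all_algebra.
From mathcomp Require Import all_classical all_reals all_analysis.

Set Implicit Arguments.
Unset Strict Implicit.
Unset Printing Implicit Defensive.

Import Order.TTheory GRing.Theory Num.Theory.
Local Open Scope classical_set_scope.
Local Open Scope ring_scope.

Section Ideals.
Variable R : comNzRingType.
Implicit Types (A I J Q M P S : set R) (s : seq R).

(* [idealr_closed] of ring_quotient is not used: it is restricted to boolean
   predicates and excludes the unit ideal. *)
Definition ideal I : Prop :=
  [/\ I 0, (forall x y, I x -> I y -> I (x + y))
    & (forall a x, I x -> I (a * x))].

Definition ideal_gen S : set R := smallest ideal S.

Definition ideal_mul I J : set R := ideal_gen [set x * y | x in I & y in J].

Fixpoint ideal_exp I (n : nat) : set R :=
  if n is n'.+1 then ideal_mul I (ideal_exp I n') else setT.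

Definition prime_ideal P : Prop :=
  [/\ ideal P, ~ P 1 & forall x y, P (x * y) -> P x \/ P y].

Definition maximal_ideal M : Prop :=
  [/\ ideal M, ~ M 1
    & forall J, ideal J -> M `<=` J -> J = M \/ J = setT].

Definition radical I : set R := [set x | exists n : nat, I (x ^+ n)].

Definition primary_ideal I : Prop :=
  [/\ ideal I, ~ I 1 & forall x y, I (x * y) -> I x \/ radical I y].

Definition primary_to M I : Prop := primary_ideal I /\ radical I = M.

Definition noetherian : Prop :=
  forall I, ideal I -> exists s, I = ideal_gen [set` s].

(* (R, M) is a local ring; local rings are Noetherian. *)
Definition local_ring M : Prop :=
  [/\ noetherian, maximal_ideal M & forall J, maximal_ideal J -> J = M].

Definition reduction Q I : Prop :=
  Q `<=` I /\
  exists n : nat, ideal_exp I n.+1 = ideal_mul Q (ideal_exp I n).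

(* N/P is a free R/A-module, for ideals P <= N and A with A N <= P.
   The set B consists of representatives in N of the elements of a basis, which
   may be infinite.  If A is proper, distinct elements of B are distinct
   modulo P by independence; if A = R, then N = P and B = set0 is a basis. *)
Definition free_quotient A N P : Prop :=
  exists B : set R,
  [/\ B `<=` N,
      (forall y, N y -> exists s (c : R -> R),
         [set` s] `<=` B /\ P (y - \sum_(x <- s) c x * x))
    & (forall s (c : R -> R), uniq s -> [set` s] `<=` B ->
         P (\sum_(x <- s) c x * x) -> forall x, x \in s -> A (c x))].

(* In dimension one, a parameter ideal is an M-primary principal ideal. *)
Definition ulrich_ideal M I : Prop :=
  primary_to M I /\
  exists a : R, let Q := ideal_gen [set a] in
  [/\ primary_to M Q, reduction Q I, I <> Q,
      ideal_exp I 2 = ideal_mul Q I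
    & free_quotient I I (ideal_exp I 2)].

Definition ulrich_ideals M : set (set R) := [set I | ulrich_ideal M I].

Definition regular_seq s : Prop :=
  (forall i, (i < size s)%N -> forall y,
     ideal_gen [set` take i s] (s`_i * y) -> ideal_gen [set` take i s] y) /\
  ~ ideal_gen [set` s] 1.

End Ideals.

(* The numerical invariants below take values in the extended reals over K;
   suprema and infima of sets of natural numbers are thus always defined. *)
Section Invariants.
Variables (K : realType) (R : comNzRingType).
Implicit Types (I J M : set R) (s : seq R).

Definition krull_dim : \bar K :=
  ereal_sup [set (n%:R)%:E | n in [set n : nat | exists p : nat -> set R,
    (forall i, (i <= n)%N -> prime_ideal (p i)) /\
    (forall i, (i < n)%N -> p i `<` p i.+1)]].

Definition depth M : \bar K :=
  ereal_sup [set ((size s)%:R)%:E | s in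
    [set s | [set` s] `<=` M /\ regular_seq s]].

Definition cohen_macaulay M : Prop := depth M = krull_dim.

(* The length of the R-module R/J: submodules of R/J correspond to the ideals
   containing J. *)
Definition quotient_length J : \bar K :=
  ereal_sup [set (n%:R)%:E | n in [set n : nat | exists p : nat -> set R,
    (forall i, (i <= n)%N -> ideal (p i) /\ J `<=` p i) /\
    (forall i, (i < n)%N -> p i `<` p i.+1)]].

Definition min_gens I : \bar K :=
  ereal_inf [set ((size s)%:R)%:E | s in [set s | I = ideal_gen [set` s]]].

Definition embdim M : \bar K := min_gens M.

(* The multiplicity of a local ring of dimension one. *)
Definition multiplicity M : \bar K :=
  limn (fun n : nat => (quotient_length (ideal_exp M n) * (n%:R^-1)%:E)%E).

End Invariants.

Arguments krull_dim K R : clear implicits.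
Arguments depth K {R} M.
Arguments cohen_macaulay K {R} M.
Arguments quotient_length K {R} J.
Arguments min_gens K {R} I.
Arguments embdim K {R} M.
Arguments multiplicity K {R} M.

(* Main.v *)
Require Import Defs.
From mathcomp Require Import all_boot all_order all_algebra.
From mathcomp Require Import all_classical all_reals all_analysis.

(* Write M[X] for the polynomials with coefficients in an ideal M. The ideals
   of R(X), the localization of R[X] at m[X], are encoded by their
   contractions to R[X]; lengths over R(X) of the M[X] / N[X] agree with those
   of M / N, so that passing to R(X) removes any hypothesis on the residue
   field.

   Let f be a polynomial whose coefficients generate m, one of them being a
   parameter a. By McCoy's theorem, f acts injectively on the associated
   graded ring extended to k(X), modulo torsion; as the lengths of m^n /
   m^(n+1) are bounded by the length of R / (a), this yields f m^N = m^(N+1)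
   over R(X) for large N. Hence e(R) is the length of R(X) / (f), and v(R) =
   e(R) forces m^2 = f m.

   Let I be an Ulrich ideal with reduction (a). It contains (a) : m, from
   which m I = f I follows, so that each m^j I / m^(j+1) I has length at most
   the rank n of I / I^2. For y in m^j outside m^(j+1) + I, the products of y
   with a basis of I / I^2 are n independent elements of m^j I / (m^(j+1) I +
   I^2). Therefore m^j is contained in (y) + m^(j+1) + I, and I^2 in m^(j+1)
   I, whenever m^j is not contained in I.

   Finally let I and J be Ulrich ideals, such that every power of m contained
   in J is contained in I. If y is in J but not in I, take j maximal with y in
   m^j + I. Then m^j is contained in I + J + m^(j+1), whence m^j I J = m^(j+1)
   I J = 0 by Nakayama's lemma, which is absurd as I J contains a regular
   element. *)

Set Implicit Arguments.
Unset Strict Implicit.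
Unset Printing Implicit Defensive.

Import Order.TTheory GRing.Theory Num.Theory.
Import numFieldNormedType.Exports.
Local Open Scope classical_set_scope.
Local Open Scope ring_scope.

(** * Ideals *)

Section IdealOperations.
Variable T : comNzRingType.
Implicit Types (D E N M : set T) (x y z s t g : T).

Lemma ideal0 D : ideal D -> D 0. Proof. by case. Qed.

Lemma idealD D x y : ideal D -> D x -> D y -> D (x + y).
Proof. by case=> _ h _; exact: h. Qed.

Lemma idealM D x y : ideal D -> D y -> D (x * y).
Proof. by case=> _ _ h; exact: h. Qed.

Lemma ideal_mulr D x y : ideal D -> D x -> D (x * y).
Proof. by rewrite mulrC; exact: idealM. Qed.

Lemma idealN D x : ideal D -> D x -> D (- x).
Proof. by move=> hD hx; rewrite -mulN1r; exact: idealM. Qed.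

Lemma idealB D x y : ideal D -> D x -> D y -> D (x - y).
Proof. by move=> hD hx hy; apply: idealD => //; exact: idealN. Qed.

Lemma ideal_sum D (I : eqType) (r : seq I) (F : I -> T) :
  ideal D -> (forall i, i \in r -> D (F i)) -> D (\sum_(i <- r) F i).
Proof.
move=> hD hF; rewrite big_seq; apply: (big_ind D) => //; first exact: ideal0.
by move=> x y; exact: idealD.
Qed.

Lemma ideal_setT : ideal (@setT T). Proof. by []. Qed.

Lemma ideal_gen_sub S D : ideal D -> S `<=` D -> ideal_gen S `<=` D.
Proof. by move=> hD hS; exact: smallest_sub. Qed.

Lemma sub_ideal_gen (S : set T) : S `<=` ideal_gen S.
Proof. exact: sub_smallest. Qed.

Lemma mem_ideal_gen (w : seq T) x : x \in w -> ideal_gen [set` w] x.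
Proof. by move=> hx; exact: sub_ideal_gen. Qed.

Lemma ideal_ideal_gen (S : set T) : ideal (ideal_gen S).
Proof.
split=> [D [hD _] | x y hx hy D hD | x y hy D hD]; first exact: ideal0.
- by apply: idealD; [case: hD | exact: hx | exact: hy].
- by apply: idealM; [case: hD | exact: hy].
Qed.

Lemma ideal_colonl N x : ideal N -> ideal [set y | N (x * y)].
Proof.
move=> iN; split=> [|y z|y z] /=; first by rewrite mulr0; exact: ideal0.
  by rewrite mulrDr; exact: idealD.
by rewrite mulrCA; exact: idealM.
Qed.

Lemma ideal_colonr N x : ideal N -> ideal [set y | N (y * x)].
Proof.
move=> iN; split=> [|y z|y z] /=; first by rewrite mul0r; exact: ideal0.
  by rewrite mulrDl; exact: idealD.
by rewrite -mulrA; exact: idealM.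
Qed.

Lemma ideal_ideal_mul D E : ideal (ideal_mul D E).
Proof. exact: ideal_ideal_gen. Qed.

Lemma mem_ideal_mul D E x y : D x -> E y -> ideal_mul D E (x * y).
Proof. by move=> hx hy; apply: sub_ideal_gen; exists x => //; exists y. Qed.

Lemma ideal_mul_sub D E N : ideal N -> (forall x y, D x -> E y -> N (x * y)) ->
  ideal_mul D E `<=` N.
Proof.
by move=> hN h; apply: ideal_gen_sub => // _ [x hx [y hy <-]]; exact: h.
Qed.

Lemma ideal_mul_subr D E : ideal E -> ideal_mul D E `<=` E.
Proof. by move=> iE; apply: ideal_mul_sub => // x y _; exact: idealM. Qed.

Lemma ideal_ideal_exp D n : ideal (ideal_exp D n).
Proof. by case: n => [|n]; [exact: ideal_setT | exact: ideal_ideal_mul]. Qed.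

Lemma ideal_expS D n : ideal_exp D n.+1 `<=` ideal_exp D n.
Proof.
elim: n => //= n IH; apply: ideal_mul_sub; first exact: ideal_ideal_mul.
by move=> x y hx /IH hy; exact: mem_ideal_mul.
Qed.

Lemma le_ideal_exp D n k : (n <= k)%N -> ideal_exp D k `<=` ideal_exp D n.
Proof.
move=> /subnK <-; elim: (k - n)%N => // i IH.
by rewrite addSn; exact: subset_trans (@ideal_expS D _) IH.
Qed.

Lemma mem_ideal_exp1 D x : D x -> ideal_exp D 1 x.
Proof. by move=> hx; rewrite -[x]mulr1; exact: mem_ideal_mul. Qed.

Lemma ideal_exp1 D : ideal D -> ideal_exp D 1 = D.
Proof.
move=> hD; apply/seteqP; split; last exact: mem_ideal_exp1.
by apply: ideal_mul_sub => // x y hx _; exact: ideal_mulr.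
Qed.

Lemma mem_ideal_expX D x n : D x -> ideal_exp D n (x ^+ n).
Proof.
by move=> hx; elim: n => // n IH; rewrite exprS; exact: mem_ideal_mul.
Qed.

Lemma mem_ideal_expD D i j x y :
  ideal_exp D i x -> ideal_exp D j y -> ideal_exp D (i + j) (x * y).
Proof.
elim: i x y => [|i IH] x y.
  by move=> _; apply: idealM; exact: ideal_ideal_exp.
pose E := [set u | forall y, ideal_exp D j y -> ideal_exp D (i.+1 + j) (u * y)].
suff h : ideal_exp D i.+1 `<=` E by move=> /h hx hy; exact: hx.
have iX := @ideal_ideal_exp D (i.+1 + j).
apply: ideal_mul_sub; last first.
  move=> u w hu hw t ht; rewrite -mulrA; apply: mem_ideal_mul => //.
  exact: IH.
split=> [t _|u w hu hw t ht|u w hw t ht].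
- by rewrite mul0r; exact: (ideal0 iX).
- by rewrite mulrDl; apply: (idealD iX); [exact: hu | exact: hw].
- by rewrite -mulrA; apply: (idealM _ iX); exact: hw.
Qed.

Lemma ideal_expD_sub D i j N : ideal N ->
  (forall x y, ideal_exp D i x -> ideal_exp D j y -> N (x * y)) ->
  ideal_exp D (i + j) `<=` N.
Proof.
elim: i N => [|i IH] N hN h; first by move=> x hx; rewrite -[x]mul1r; exact: h.
apply: ideal_mul_sub => // x y hx.
have hE := ideal_colonl x hN.
suff : ideal_exp D (i + j) `<=` [set u | N (x * u)] by apply.
apply: IH => // u w hu hw /=; rewrite mulrA.
by apply: h => //; exact: mem_ideal_mul.
Qed.

Definition adjoin N x : set T := [set z | exists t, N (z - t * x)].

Lemma ideal_adjoin N x : ideal N -> ideal (adjoin N x).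
Proof.
move=> hN; split=> [|y z [t ht] [u hu]|y z [t ht]].
- by exists 0; rewrite mul0r subr0; exact: ideal0.
- exists (t + u); rewrite mulrDl opprD addrACA; exact: idealD.
- by exists (y * t); rewrite -mulrA -mulrBr; exact: idealM.
Qed.

Lemma sub_adjoin N x : N `<=` adjoin N x.
Proof. by move=> z hz; exists 0; rewrite mul0r subr0. Qed.

Lemma mem_adjoin N x : ideal N -> adjoin N x x.
Proof. by move=> hN; exists 1; rewrite mul1r subrr; exact: ideal0. Qed.

Lemma adjoin_sub N E x : ideal E -> N `<=` E -> E x -> adjoin N x `<=` E.
Proof.
move=> hE hN hx z [t ht]; rewrite -(subrK (t * x) z).
by apply: idealD => //; [exact: hN | exact: idealM].
Qed.

Lemma ideal_adjoins N w : ideal N -> ideal (foldl adjoin N w).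
Proof.
by elim: w N => //= x w IH N hN; apply: IH; exact: ideal_adjoin.
Qed.

Lemma sub_adjoins N w : N `<=` foldl adjoin N w.
Proof.
elim: w N => [|x w IH] N //.
by move=> z hz; apply: IH; exact: sub_adjoin.
Qed.

Lemma adjoinsS N N' w : N `<=` N' -> foldl adjoin N w `<=` foldl adjoin N' w.
Proof.
elim: w N N' => [|x w IH] N N' h //; apply: IH => z [t ht]; exists t; exact: h.
Qed.

Lemma mem_adjoins N w x : ideal N -> x \in w -> foldl adjoin N w x.
Proof.
elim: w N => //= y w IH N hN; rewrite inE => /orP[/eqP->|hx].
  by apply: sub_adjoins; exact: mem_adjoin.
by apply: IH => //; exact: ideal_adjoin.
Qed.

Lemma adjoins_sub N E w : ideal E -> N `<=` E -> (forall x, x \in w -> E x) ->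
  foldl adjoin N w `<=` E.
Proof.
elim: w N => //= x w IH N hE hN hw; apply: IH => //.
  by apply: adjoin_sub => //; apply: hw; rewrite inE eqxx.
by move=> y hy; apply: hw; rewrite inE hy orbT.
Qed.

Lemma ideal_gen_seq w : ideal_gen [set` w] = foldl adjoin [set 0] w.
Proof.
have h0 : ideal [set 0 : T].
  split=> // [x y|x y] /= -> ; last by rewrite mulr0.
  by move=> ->; rewrite addr0.
apply/seteqP; split.
  apply: ideal_gen_sub; first exact: ideal_adjoins.
  by move=> x hx; exact: mem_adjoins.
apply: adjoins_sub; first exact: ideal_ideal_gen.
  by move=> _ ->; apply: ideal0; exact: ideal_ideal_gen.
exact: mem_ideal_gen.
Qed.

Lemma adjoins_gen N w D : ideal N -> D = ideal_gen [set` w] ->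
  D `<=` foldl adjoin N w.
Proof.
move=> hN ->; rewrite ideal_gen_seq; apply: adjoinsS => _ ->; exact: ideal0.
Qed.

Lemma ideal_gen1P a x : ideal_gen [set a] x <-> exists t, x = t * a.
Proof.
split; last first.
  move=> [t ->]; apply: (idealM _ (ideal_ideal_gen _)).
  by apply: sub_ideal_gen.
apply: (@ideal_gen_sub _ [set x | exists t, x = t * a]); last first.
  by move=> _ ->; exists 1; rewrite mul1r.
split=> [|_ _ [t ->] [u ->]|y _ [t ->]]; first by exists 0; rewrite mul0r.
  by exists (t + u); rewrite mulrDl.
by exists (y * t); rewrite mulrA.
Qed.

End IdealOperations.

Arguments adjoin {T} N x.

(** * Lengths over a localization *)

Section LocalizedLength.
Variables (T : comNzRingType) (P : set T).
Hypothesis primeP : prime_ideal P.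
Implicit Types (D E N M : set T) (x y z s t g : T).

(* The contractions to T of the ideals of the localization of T at P. *)
Definition saturated D : Prop :=
  ideal D /\ forall s z, ~ P s -> D (s * z) -> D z.

(** The contraction to T of the extension of D to the localization at [P]. *)
Definition saturation D : set T := [set z | exists2 s, ~ P s & D (s * z)].

(* There are k strict inclusions, and the last ideal of the chain is M. *)
Fixpoint chain N M (k : nat) : Prop :=
  [/\ saturated M, N `<=` M &
    if k is k'.+1 then exists2 E, E `<` M & chain N E k' else True].

(** An upper bound for the length of M / N over the localization; bounding chains makes sense before
    any length is known to be finite. *)
Definition length_le N M n : Prop := forall k, chain N M k -> (k <= n)%N.

Lemma prime_ideal_id : ideal P. Proof. by case: primeP. Qed.

Lemma notin_prime1 : ~ P 1. Proof. by case: primeP. Qed.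

Lemma notin_primeM s t : ~ P s -> ~ P t -> ~ P (s * t).
Proof. by move=> hs ht; case: primeP => _ _ h /h[]. Qed.

Lemma notin_primeB s t : ~ P s -> P t -> ~ P (s - t).
Proof.
move=> hs ht h; apply: hs; rewrite -(subrK t s).
by apply: idealD => //; exact: prime_ideal_id.
Qed.

Lemma saturated_setT : saturated setT. Proof. by []. Qed.

Lemma saturatedI D E : saturated D -> saturated E -> saturated (D `&` E).
Proof.
move=> [hD sD] [hE sE]; split; last first.
  by move=> s z hs [hz hz']; split; [exact: sD hs hz | exact: sE hs hz'].
split=> [|x y [? ?] [? ?]|x y [? ?]].
- by split; exact: ideal0.
- by split; exact: idealD.
- by split; exact: idealM.
Qed.

Lemma sub_saturation D : D `<=` saturation D.
Proof. by move=> z hz; exists 1; [exact: notin_prime1 | rewrite mul1r]. Qed.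

Lemma saturated_saturation D : ideal D -> saturated (saturation D).
Proof.
move=> hD; split; last first.
  move=> s z hs [t ht hz]; exists (t * s); first exact: notin_primeM.
  by rewrite -mulrA.
split=> [|x y [s hs hx] [t ht hy]|x y [s hs hy]].
- by exists 1; [exact: notin_prime1 | rewrite mulr0; exact: ideal0].
- exists (s * t); first exact: notin_primeM.
  rewrite mulrDr -{1}mulrA (mulrC t) mulrA; apply: idealD => //.
    exact: ideal_mulr.
  by rewrite -mulrA; exact: idealM.
- by exists s => //; rewrite mulrCA; exact: idealM.
Qed.

Lemma saturation_sub D E : saturated E -> D `<=` E -> saturation D `<=` E.
Proof. by move=> [_ hE] h z [s hs /h]; exact: hE. Qed.

Lemma saturationS D E : D `<=` E -> saturation D `<=` saturation E.
Proof. by move=> h z [s hs /h hz]; exists s. Qed.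

Definition ideal_add D E : set T := [set z | exists2 x, D x & E (z - x)].

Lemma ideal_ideal_add D E : ideal D -> ideal E -> ideal (ideal_add D E).
Proof.
move=> hD hE; split=> [|x y [u hu hx] [v hv hy]|x y [u hu hy]].
- by exists 0; [|rewrite subr0]; exact: ideal0.
- by exists (u + v); [|rewrite opprD addrACA]; exact: idealD.
- by exists (x * u); [|rewrite -mulrBr]; exact: idealM.
Qed.

Lemma ideal_addl D E : ideal E -> D `<=` ideal_add D E.
Proof. by move=> hE x hx; exists x; rewrite ?subrr//; exact: ideal0. Qed.

Lemma ideal_addr D E : ideal D -> E `<=` ideal_add D E.
Proof. by move=> hD x hx; exists 0; rewrite ?subr0//; exact: ideal0. Qed.

Lemma ideal_add_sub D E N : ideal N -> D `<=` N -> E `<=` N ->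
  ideal_add D E `<=` N.
Proof.
move=> hN hD hE z [x /hD hx /hE hzx]; rewrite -(subrK x z); exact: idealD.
Qed.

Lemma chain0 N M : saturated M -> N `<=` M -> chain N M 0.
Proof. by []. Qed.

Lemma chain_saturated N M k : chain N M k -> saturated M.
Proof. by case: k => [|k] []. Qed.

Lemma chain_sub N M k : chain N M k -> N `<=` M.
Proof. by case: k => [|k] []. Qed.

Lemma proper_sub_trans (A B C : set T) : A `<` B -> B `<=` C -> A `<` C.
Proof.
move=> [AB nBA] BC; split; first exact: subset_trans BC.
by move=> CA; apply: nBA; exact: subset_trans CA.
Qed.

Lemma chain_subr N M M' k : saturated M' -> M `<=` M' -> chain N M k ->
  chain N M' k.
Proof.
move=> sM' hM; case: k => [|k] [sM NM h]; (split=> //;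
  first exact: subset_trans hM) => //.
by case: h => E ltE c; exists E => //; exact: proper_sub_trans hM.
Qed.

Lemma chain_subl N N' M k : N' `<=` N -> chain N M k -> chain N' M k.
Proof.
move=> hN; elim: k M => [|k IH] M [sM NM h]; (split=> //;
  first exact: subset_trans NM) => //.
by case: h => E ltE /IH c; exists E.
Qed.

Lemma chain_rcons N M M' k : chain N M k -> saturated M' -> M `<` M' ->
  chain N M' k.+1.
Proof.
move=> c sM' lt; split=> //; last by exists M.
by apply: subset_trans (properW lt); exact: chain_sub c.
Qed.

Lemma chain_cat N D M i j : chain N D i -> chain D M j -> chain N M (i + j).
Proof.
move=> c1; elim: j M => [|j IH] M c2.
  rewrite addn0; apply: chain_subr c1; first exact: chain_saturated c2.
  exact: chain_sub c2.
case: (c2) => sM _ [E ltE /IH c]; rewrite addnS; exact: chain_rcons ltE.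
Qed.

Lemma length_leS N N' M M' n : N `<=` N' -> saturated M -> M' `<=` M ->
  length_le N M n -> length_le N' M' n.
Proof.
move=> hN sM hM h k c; apply: h; apply: chain_subr hM _ => //.
exact: chain_subl c.
Qed.

Lemma length_le_leq N M n n' : (n <= n')%N -> length_le N M n ->
  length_le N M n'.
Proof. by move=> le h k /h hk; exact: leq_trans le. Qed.

(* A strict step of a chain stays strict after intersecting with D or after
   adding D, by the modular law. *)
Lemma length_le_add N D M a b : saturated D -> N `<=` D -> D `<=` M ->
  length_le N D a -> length_le D M b -> length_le N M (a + b).
Proof.
move=> sD ND DM la lb k c; have sM := chain_saturated c.
have iD : ideal D by case: sD.
suff key E l : E `<=` M -> chain N E l -> exists i j,
    [/\ (l <= i + j)%N, chain N (E `&` D) i &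
      chain D (saturation (ideal_add E D)) j].
  have [i [j [le ci cj]]] := key M k (@subset_refl _ M) c.
  apply: leq_trans le _; apply: leq_add.
    by apply: la; apply: chain_subr ci => // x [].
  apply: lb; apply: chain_subr cj => //; apply: saturation_sub => //.
  by apply: ideal_add_sub => //; case: sM.
elim: l E => [|l IH] E EM c'; have sE := chain_saturated c';
  have iE : ideal E by case: sE.
  exists 0%N, 0%N; split=> //.
    apply: chain0; first exact: saturatedI.
    by move=> x hx; split; [exact: (chain_sub c') | exact: ND].
  apply: chain0; first exact/saturated_saturation/ideal_ideal_add.
  exact: subset_trans (ideal_addr iE) (@sub_saturation _).
case: c' => _ NE [E2 [ltE nE] c2].
have iE2 : ideal E2 by case: (chain_saturated c2).
have [i [j [le ci cj]]] := IH E2 (subset_trans ltE EM) c2.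
have sI := saturatedI sE sD.
have sU := saturated_saturation (ideal_ideal_add iE iD).
have leI : E2 `&` D `<=` E `&` D by move=> x [/ltE].
have leU : saturation (ideal_add E2 D) `<=` saturation (ideal_add E D).
  by apply: saturationS => x [y /ltE ? ?]; exists y.
have [hI|hI] := pselect (E `&` D `<=` E2 `&` D); last first.
  exists i.+1, j; split; first by rewrite addSn ltnS.
    exact: chain_rcons ci sI _.
  exact: chain_subr cj.
have [hU|hU] := pselect (saturation (ideal_add E D) `<=`
                         saturation (ideal_add E2 D)); last first.
  exists i, j.+1; split; first by rewrite addnS ltnS.
    exact: chain_subr ci.
  exact: chain_rcons cj sU _.
exfalso; apply: nE => z hz.
have /hU[s hs [u hu hD]] : saturation (ideal_add E D) z.
  by apply: sub_saturation; exact: ideal_addl.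
have : (E `&` D) (s * z - u).
  by split=> //; apply: idealB => //; [exact: idealM | exact: ltE].
move=> /hI[hsz _]; have [_ h] := chain_saturated c2; apply: h hs _.
by rewrite -(subrK u (s * z)); exact: idealD.
Qed.

Lemma length_le_max N M n : saturated M -> N `<=` M -> length_le N M n ->
  exists2 k, chain N M k & length_le N M k.
Proof.
move=> sM NM h.
have ex : exists k, `[< chain N M k >] by exists 0%N; apply/asboolP.
have ub k : `[< chain N M k >] -> (k <= n)%N by move=> /asboolP /h.
case: (ex_maxnP ex ub) => k /asboolP ck hk; exists k => // l cl.
by apply: hk; exact/asboolP.
Qed.

Lemma proper_mem (A B : set T) : A `<` B -> exists2 z, B z & ~ A z.
Proof.
move=> [_ h]; apply: contrapT => nex; apply: h => z hz.
by apply: contrapT => nz; apply: nex; exists z.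
Qed.

(** Over the localization, M / N lies in a cyclic module killed by P. Given two strict steps below
    M, an element of the middle ideal outside the lowest one is, up to a factor outside P, congruent
    to t x with t outside P; so the middle ideal contains x, and hence M. *)
Lemma length_le_adjoin N M x : ideal N -> (forall t, P t -> N (t * x)) ->
  M `<=` saturation (adjoin N x) -> length_le N M 1.
Proof.
move=> iN hx hM [|[|k]] // [sM NM [D1 ltD1 [[iD1 sD1] ND1 [D0 lt0 c0]]]].
exfalso; have [_ nD1] := ltD1; apply: nD1.
have [z hz nz] := proper_mem lt0.
have [_ sD0] := chain_saturated c0; have ND0 := chain_sub c0.
have [s hs [t ht]] := hM _ (properW ltD1 hz).
have nt : ~ P t.
  move=> /hx htx; apply: nz; apply: sD0 hs _; apply: ND0.
  by rewrite -(subrK (t * x) (s * z)); exact: idealD.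
have xD1 : D1 x.
  apply: sD1 nt _; rewrite -[t * x](subKr (s * z)).
  by apply: idealB; [|exact: idealM | exact: ND1].
apply: subset_trans hM _; apply: saturation_sub => //.
exact: adjoin_sub.
Qed.

Lemma length_le_adjoins N M w : saturated N -> saturated M -> N `<=` M ->
  (forall x, x \in w -> M x) ->
  (forall x t, x \in w -> P t -> N (t * x)) ->
  M `<=` saturation (foldl adjoin N w) -> length_le N M (size w).
Proof.
move=> + sM; elim: w N => [|x w IH] N sN NM wM hw hM.
  move=> [|k] // [_ _ [E [_ nE] /chain_sub NE]]; exfalso; apply: nE.
  apply: subset_trans NE; apply: subset_trans hM _; exact: saturation_sub.
have iN : ideal N by case: sN.
set D := saturation (adjoin N x).
have sD : saturated D by exact/saturated_saturation/ideal_adjoin.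
have ND : N `<=` D by move=> z hz; exact/sub_saturation/sub_adjoin.
have DM : D `<=` M.
  apply: saturation_sub => //; apply: adjoin_sub => //; first by case: sM.
  by apply: wM; rewrite inE eqxx.
rewrite -[size _]add1n; apply: (length_le_add sD) => //.
  apply: (@length_le_adjoin _ _ x) => //.
  by move=> t; apply: hw; rewrite inE eqxx.
apply: IH => //.
- by move=> y hy; apply: wM; rewrite inE hy orbT.
- by move=> y t hy ht; apply/ND/hw => //; rewrite inE hy orbT.
- apply: subset_trans hM _; apply: saturationS => /=; apply: adjoinsS.
  exact: sub_saturation.
Qed.

(** After localization g M covers M', so that distinct saturated ideals between N' and M' have
    distinct preimages in M under multiplication by g. *)
Lemma pull_chain N M N' M' g k : saturated N -> saturated M -> N `<=` M ->
  (forall z, N z -> N' (g * z)) ->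
  M' `<=` saturation [set g * z | z in M] ->
  chain N' M' k -> chain N M k.
Proof.
move=> sN sM NM hN hM.
pose phi E : set T := [set z | M z /\ E (g * z)].
have sphi E : saturated E -> saturated (phi E).
  move=> [iE sE]; have [iM sM'] := sM; split; last first.
    move=> s z hs [h1 h2]; split; first exact: sM' h1.
    by apply: sE hs _; rewrite mulrCA.
  split=> [|x y [? ?] [? ?]|x y [? ?]].
  - by split; rewrite ?mulr0; exact: ideal0.
  - by split; rewrite ?mulrDr; exact: idealD.
  - by split; rewrite 1?mulrCA; exact: idealM.
have hphi E : N' `<=` E -> N `<=` phi E.
  by move=> h z hz; split; [exact: NM | exact/h/hN].
suff key E : E `<=` M' -> chain N' E k -> chain N (phi E) k.
  move=> c; apply: (@chain_subr _ (phi M')) => //; first by move=> z [].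
  exact: key.
elim: k E => [|k IH] E EM' c; have [? ? h] := c; split=> //;
  try exact: sphi; try exact: hphi.
case: h => F [FE nF] cF; exists (phi F); last first.
  by apply: IH => //; exact: subset_trans EM'.
split=> [z [? ?]|hEF]; first by split=> //; exact: FE.
apply: nF => z hz; have [s hs [u hu eu]] := hM _ (EM' _ hz).
have [_ sF] := chain_saturated cF.
have iE : ideal E by case: (chain_saturated c).
apply: sF hs _; rewrite -eu.
suff : phi F u by case.
by apply: hEF; split=> //; rewrite eu; exact: idealM.
Qed.

(** Multiplication by g is injective from M / N to T / N', so strict inclusions stay strict for the
    images, the last of which is g M + N' over the localization. *)
Lemma push_chain N M N' g k : ideal N' ->
  (forall z, N z -> N' (g * z)) -> (forall z, M z -> N' (g * z) -> N z) ->
  chain N M k ->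
  chain N' (saturation (ideal_add [set g * z | z in M] N')) k.
Proof.
move=> iN' hN hN'.
pose phi E := saturation (ideal_add [set g * z | z in E] N').
have sphi E : ideal E -> saturated (phi E).
  move=> iE; apply: saturated_saturation; apply: ideal_ideal_add => //.
  split=> [|_ _ [x hx <-] [y hy <-]|x _ [y hy <-]].
  - by exists 0; [exact: ideal0 | rewrite mulr0].
  - by exists (x + y); [exact: idealD | rewrite mulrDr].
  - by exists (x * y); [exact: idealM | rewrite mulrCA].
have sub E : ideal E -> N' `<=` phi E.
  move=> iE z hz; apply: sub_saturation; exists 0; last by rewrite subr0.
  by exists 0; [exact: ideal0 | rewrite mulr0].
suff key E : E `<=` M -> chain N E k -> chain N' (phi E) k by exact: key.
elim: k E => [|k IH] E EM c; have [[iE sE] NE h] := c; split=> //;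
  try exact: sphi; try exact: sub.
case: h => F [FE nF] cF; exists (phi F); last first.
  by apply: IH => //; exact: subset_trans EM.
split.
  apply: saturationS => z [_ [x hx <-] hz].
  by exists (g * x) => //; exists x => //; exact: FE.
move=> hEF; apply: nF => z hz.
have [iF sF] := chain_saturated cF.
have /hEF[s hs [_ [u hu <-] hsu]] : phi E (g * z).
  apply: sub_saturation; exists (g * z); first by exists z.
  by rewrite subrr; exact: ideal0.
apply: sF hs _; rewrite -(subrK u (s * z)); apply: idealD => //.
apply: (chain_sub cF); apply: hN'.
  apply: EM; apply: idealB => //; [exact: idealM | exact: FE].
by rewrite mulrBr mulrCA.
Qed.

Lemma ideal_image_mul g D : ideal D -> ideal [set g * z | z in D].
Proof.
move=> iD; split=> [|_ _ [x hx <-] [y hy <-]|x _ [y hy <-]].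
- by exists 0; [exact: ideal0 | rewrite mulr0].
- by exists (x + y); [exact: idealD | rewrite mulrDr].
- by exists (x * y); [exact: idealM | rewrite mulrCA].
Qed.

(** The ideal g D over the localization, contracted to T. *)
Definition dilate g D : set T := saturation [set g * z | z in D].

Lemma saturated_dilate g D : ideal D -> saturated (dilate g D).
Proof. by move=> iD; exact/saturated_saturation/ideal_image_mul. Qed.

Lemma mem_dilate g D z : D z -> dilate g D (g * z).
Proof. by move=> hz; apply: sub_saturation; exists z. Qed.

Lemma dilateS g D E : D `<=` E -> dilate g D `<=` dilate g E.
Proof. by move=> h; apply: saturationS => _ [z /h hz <-]; exists z. Qed.

Lemma dilate_sub g D : saturated D -> dilate g D `<=` D.
Proof.
move=> sD; apply: saturation_sub => // _ [z hz <-].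
by apply: idealM => //; case: sD.
Qed.

(** The length of M / g N is computed through g M and through N. As g M / g N is at most as long as
    M / N, which has finite length, the latter cancels. *)
Lemma length_le_dilate N M g h c : saturated N -> saturated M -> N `<=` M ->
  length_le N M h -> length_le (dilate g M) M c -> length_le (dilate g N) N c.
Proof.
move=> sN sM NM /(length_le_max sM NM)[L cL lL] lc k ck.
have [iN _] := sN; have [iM _] := sM.
have sgM := saturated_dilate g iM.
rewrite -(leq_add2l L) [(L + k)%N]addnC.
apply: (length_le_add sgM) (chain_cat ck cL) => //.
- exact: dilateS.
- exact: dilate_sub.
- move=> q cq; apply: lL; apply: (pull_chain sN sM NM _ _ cq); last exact: subset_refl.
  by move=> z; exact: mem_dilate.
Qed.

(** The same two computations: as g is regular, g M / g N is at least as long as M / N, which yields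
    the inequality opposite to [length_le_dilate]. *)
Lemma length_ge_dilate N M g h c : saturated N -> saturated M -> N `<=` M ->
  (forall z, g * z = 0 -> z = 0) ->
  length_le N M h -> length_le (dilate g N) N c -> length_le (dilate g M) M c.
Proof.
move=> sN sM NM g0 /(length_le_max sM NM)[L cL lL] lc k ck.
have [iN sN'] := sN; have [iM _] := sM.
rewrite -(leq_add2l L) [leqRHS]addnC.
apply: (length_le_add sN _ _ lc lL) => //; first exact: dilate_sub.
apply: chain_cat ck; apply: chain_subr (push_chain (g := g) _ _ _ cL).
- exact: saturated_dilate.
- apply: saturation_sub; first exact: saturated_dilate.
  apply: ideal_add_sub; last exact: dilateS.
    by case: (saturated_dilate g iM).
  exact: sub_saturation.
- by case: (saturated_dilate g iN).
- by move=> z; exact: mem_dilate.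
- move=> z _ [s hs [u hu e]]; apply: sN' hs _.
  have /eqP : g * (s * z - u) = 0 by rewrite mulrBr e mulrCA subrr.
  by move=> /eqP/g0/eqP; rewrite subr_eq0 => /eqP->.
Qed.

(** Induction on the generators. Modulo x the others vanish by the induction hypothesis, so that s x
    lies in N + P x for some s outside P; then (s - t) x is in N for some t in P, and s - t is
    outside P. *)
Lemma saturated_nakayama N (w : seq T) : saturated N ->
  (forall x, x \in w ->
    saturation (ideal_add N (ideal_mul P (ideal_gen [set` w]))) x) ->
  forall x, x \in w -> N x.
Proof.
have iP := prime_ideal_id.
elim: w N => // x u IH N sN hw.
have iN : ideal N by case: sN.
set G := ideal_gen _ in hw.
have GE E : ideal E -> (forall t y, P t -> y \in x :: u -> E (t * y)) ->
    ideal_mul P G `<=` E.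
  move=> iE hE; apply: ideal_mul_sub => // t z ht.
  suff : G `<=` [set z | E (t * z)] by apply.
  apply: ideal_gen_sub => [|y hy /=]; last exact: hE.
  exact: ideal_colonl.
have sN1 := saturated_saturation (ideal_adjoin x iN).
have NN1 : N `<=` saturation (adjoin N x).
  by move=> z hz; exact/sub_saturation/sub_adjoin.
have N1x : saturation (adjoin N x) x by exact/sub_saturation/mem_adjoin.
have uN1 : forall z, z \in u -> saturation (adjoin N x) z.
  apply: IH => // z hz; have /hw : z \in x :: u by rewrite inE hz orbT.
  have iA : ideal (ideal_add (saturation (adjoin N x))
                     (ideal_mul P (ideal_gen [set` u]))).
    by apply: ideal_ideal_add; [case: sN1 | exact: ideal_ideal_mul].
  apply: saturationS; apply: ideal_add_sub => //.
    apply: subset_trans NN1 _; exact/ideal_addl/ideal_ideal_mul.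
  apply: GE => // t y ht; rewrite inE => /orP[/eqP->|hy].
    apply: ideal_addl; first exact: ideal_ideal_mul.
    by apply: idealM => //; case: sN1.
  apply: ideal_addr; first by case: sN1.
  by apply: mem_ideal_mul => //; exact: sub_ideal_gen.
pose E := [set z | exists2 t, P t & N (z - t * x)].
have iE : ideal E.
  split=> [|y z [t Pt ht] [v Pv hv]|y z [t Pt ht]].
  - by exists 0; [|rewrite mul0r subr0]; exact: ideal0.
  - by exists (t + v); [|rewrite mulrDl opprD addrACA]; exact: idealD.
  - by exists (y * t); [|rewrite -mulrA -mulrBr]; exact: idealM.
have sE := saturated_saturation iE.
have Nx : N x.
  have [s hs [t Pt]] : saturation E x.
    have hE : ideal_add N (ideal_mul P G) `<=` saturation E.
      apply: ideal_add_sub; first by case: sE.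
        move=> z hz; apply: sub_saturation; exists 0; first exact: ideal0.
        by rewrite mul0r subr0.
      apply: GE; first by case: sE.
      move=> t y ht; rewrite inE => /orP[/eqP->|/uN1].
        by apply: sub_saturation; exists t; rewrite ?subrr//; exact: ideal0.
      move=> [s hs [v hv]]; exists s => //; exists (t * v); first exact: ideal_mulr.
      by rewrite mulrCA -mulrA -mulrBr; exact: idealM.
    exact: (saturation_sub sE hE (hw _ (mem_head _ _))).
  by rewrite -mulrBl; case: (sN) => _ h; apply: h; exact: notin_primeB.
move=> z; rewrite inE => /orP[/eqP->//|/uN1].
by apply: saturation_sub => //; exact: adjoin_sub.
Qed.
End LocalizedLength.

(** * Local rings and their polynomial extensions *)

Section MaximalIdeals.
Variable T : comNzRingType.

Lemma sub_maximal_ideal (D : set T) : ideal D -> ~ D 1 ->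
  exists2 J, maximal_ideal J & D `<=` J.
Proof.
move=> iD D1.
pose Q (A : set T) := A = set0 \/ [/\ ideal A, ~ A 1 & D `<=` A].
have [|A [QA hA]] := @Zorn_bigcup T Q.
  move=> F FQ Ftot.
  have [F0|] := pselect (forall A, F A -> A = set0).
    by left; rewrite bigcup0.
  move=> /existsNP[A0 /not_implyP[FA0 nA0]]; right.
  have hQ A x : F A -> A x -> [/\ ideal A, ~ A 1 & D `<=` A].
    by move=> /FQ[->|].
  have /set0P[x0 Ax0] : A0 != set0 by apply/eqP.
  have [iA0 A01 DA0] := hQ _ _ FA0 Ax0.
  split; last by move=> z /DA0 hz; exists A0.
    split=> [|x y [A FA Ax] [B FB By]|x y [A FA Ay]].
    - by exists A0 => //; exact: ideal0.
    - have [iA _ _] := hQ _ _ FA Ax; have [iB _ _] := hQ _ _ FB By.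
      have [AB|BA] := Ftot _ _ FA FB.
        by exists B => //; apply: idealD => //; exact: AB.
      by exists A => //; apply: idealD => //; exact: BA.
    - have [iA _ _] := hQ _ _ FA Ay.
      by exists A => //; exact: idealM.
  by move=> [A FA A1]; have [_ h _] := hQ _ _ FA A1; exact: h.
have QD : Q D by right; split.
case: QA => [A0|[iA A1 DA]].
  exfalso; apply: (hA D) => //; rewrite A0; split=> // h.
  by have := h 0 (ideal0 iD).
exists A => //; split=> // J iJ AJ.
have [JA|nJA] := pselect (J `<=` A); first by left; apply/seteqP.
right; apply/seteqP; split=> // x _.
have [J1|J1] := pselect (J 1); first by rewrite -[x]mulr1; exact: idealM.
exfalso; apply: (hA J) => //; right; split=> //.
exact: subset_trans AJ.
Qed.

End MaximalIdeals.

Section LocalRings.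
Variables (R : comNzRingType) (m : set R).
Hypothesis hloc : local_ring m.
Implicit Types (D E N M : set R) (x y z : R).

Lemma ideal_max : ideal m. Proof. by case: hloc => _ []. Qed.

Lemma local_unit x : ~ m x -> exists y, y * x = 1.
Proof.
move=> mx; have [/ideal_gen1P[y ->]|n1] := pselect (ideal_gen [set x] 1).
  by exists y.
have [J mJ hJ] := sub_maximal_ideal (ideal_ideal_gen _) n1.
case: hloc => _ _ /(_ _ mJ) eJ; exfalso; apply: mx; rewrite -eJ.
by apply: hJ; apply: sub_ideal_gen.
Qed.

Lemma prime_max : prime_ideal m.
Proof.
case: hloc => _ [im m1 _] _; split=> // x y hxy.
have [|/local_unit[u hu]] := pselect (m x); first by left.
by right; rewrite -[y]mul1r -hu -mulrA; exact: idealM.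
Qed.

(** Elements outside m are units, so localizing at m changes nothing and [length_le m] bounds
    ordinary lengths. *)
Lemma local_saturated D : ideal D -> saturated m D.
Proof.
move=> iD; split=> // s z /local_unit[u hu] hsz.
by rewrite -[z]mul1r -hu -mulrA; exact: idealM.
Qed.

Lemma local_fg D : ideal D -> exists w : seq R, D = ideal_gen [set` w].
Proof. by case: hloc => h _ _ /h. Qed.

Lemma local_nakayama N D : ideal N -> ideal D ->
  D `<=` ideal_add N (ideal_mul m D) -> D `<=` N.
Proof.
move=> iN /local_fg[w ->] h; apply: ideal_gen_sub => //.
apply: (saturated_nakayama prime_max (local_saturated iN)) => x hx.
by apply: (sub_saturation prime_max); apply: h; exact: sub_ideal_gen.
Qed.

(** Each generator is chosen outside the ideal reached so far and thus accounts for one strict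
    step. *)
Lemma length_le_gens N M h : ideal N -> ideal M -> N `<=` M ->
  length_le m N M h -> exists w : seq R, [/\ (size w <= h)%N,
    (forall x, x \in w -> M x) & M `<=` foldl adjoin N w].
Proof.
elim: h N => [|h IH] N iN iM NM lN.
all: have sN := local_saturated iN; have sM := local_saturated iM.
all: have [MN|nMN] := pselect (M `<=` N).
- by exists [::].
- suff : chain m N M 1 by move=> /lN.
  by split=> //; exists N; split.
- by exists [::]; split=> // z hz; apply: sub_adjoins; exact: MN.
have [x hx nx] := @proper_mem _ N M (conj NM nMN).
have iN' := ideal_adjoin x iN.
have N'M : adjoin N x `<=` M by exact: adjoin_sub.
have NN' := @sub_adjoin _ N x.
have [|w [sw wM hw]] := IH _ iN' iM N'M.
  move=> k ck; rewrite -ltnS -add1n; apply: lN; apply: chain_cat ck.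
  split=> //; first exact: local_saturated.
  exists N => //; split=> // hh; apply: nx; apply: hh; exact: mem_adjoin.
exists (x :: w); split=> // y; rewrite inE => /orP[/eqP->//|]; exact: wM.
Qed.

(** By independence, adjoining the [b x] to N one after the other gives strict steps. Their number
    exhausts the length, so the [b x] span M modulo N. *)
Lemma length_le_basis (B : seq R) (b : R -> R) N M : uniq B -> ideal N ->
  ideal M -> N `<=` M -> length_le m N M (size B) ->
  (forall x, x \in B -> M (b x)) ->
  (forall c : R -> R, N (\sum_(x <- B) c x * b x) ->
     forall x, x \in B -> m (c x)) ->
  forall z, M z -> exists c, N (z - \sum_(x <- B) c x * b x).
Proof.
move=> + + iM; elim: B N => [|x B IH] N /=.
  move=> _ iN NM lN _ _ z hz; exists (fun=> 0); rewrite big_nil subr0.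
  apply: contrapT => nz.
  suff /lN : chain m N M 1 by [].
  split=> //; first exact: local_saturated.
  exists N; last by split=> //; exact: local_saturated.
  by split=> // h; apply: nz; exact: h.
move=> /andP[xB uB] iN NM lN bM hB z hz.
have iN' := ideal_adjoin (b x) iN.
have N'M : adjoin N (b x) `<=` M.
  by apply: adjoin_sub => //; apply: bM; rewrite inE eqxx.
have sumE c t (F : R -> R) : \sum_(y <- B) (if y == x then t else c y) * F y =
    \sum_(y <- B) c y * F y.
  rewrite big_seq [RHS]big_seq; apply: eq_bigr => y hy.
  by case: eqP => // e; rewrite -e hy in xB.
have hB' t c : N (\sum_(y <- B) c y * b y - t * b x) ->
    m t /\ forall y, y \in B -> m (c y).
  move=> h; have hN : N (\sum_(y <- x :: B) (if y == x then - t else c y) * b y).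
    by rewrite big_cons eqxx sumE mulNr addrC.
  have mB := hB _ hN; split.
    have := mB x (mem_head _ _); rewrite eqxx => /(idealN ideal_max).
    by rewrite opprK.
  move=> y hy; have := mB y; rewrite inE hy orbT => /(_ isT).
  by case: eqP => // e; rewrite -e hy in xB.
have [|||c [t ht]] := IH _ uB iN' N'M _ _ _ z hz.
- move=> k ck; rewrite -ltnS -add1n; apply: lN; apply: chain_cat ck.
  split; [exact: local_saturated | exact: sub_adjoin | exists N].
    split=> [|h]; first exact: sub_adjoin.
    have [m1 _] : m (-1) /\ forall y, y \in B -> m ((fun=> 0) y).
      apply: hB'; rewrite big1 ?sub0r ?mulN1r ?opprK.
        by apply: h; exact: mem_adjoin.
      by move=> i _; rewrite mul0r.
    have := idealN ideal_max m1; rewrite opprK; exact: notin_prime1 prime_max.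
  by split=> //; exact: local_saturated.
- by move=> y hy; apply: bM; rewrite inE hy orbT.
- by move=> c [t /hB'[_]].
exists (fun y => if y == x then t else c y).
by rewrite big_cons eqxx sumE opprD addrA addrAC.
Qed.

Lemma length_le_fg N M : ideal N -> ideal M -> N `<=` M ->
  ideal_mul m M `<=` N -> exists h, length_le m N M h.
Proof.
move=> iN iM NM mMN; have [w eM] := local_fg iM; exists (size w).
have wM x : x \in w -> M x by rewrite eM; exact: mem_ideal_gen.
have [sN sM] := (local_saturated iN, local_saturated iM).
apply: (length_le_adjoins prime_max sN sM) => //.
  by move=> x t hx ht; apply: mMN; apply: mem_ideal_mul => //; exact: wM.
by move=> z hz; apply: (sub_saturation prime_max); exact: (adjoins_gen iN eM).
Qed.

End LocalRings.

(** * Extension of ideals and lengths from R to R(X) *)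

Section PolynomialExtension.
Variable R : comNzRingType.
Implicit Types (D E N M : set R) (p q f : {poly R}).

Definition poly_ideal M : set {poly R} := [set p | forall i, M p`_i].

Lemma ideal_poly_ideal M : ideal M -> ideal (poly_ideal M).
Proof.
move=> iM; split=> [i|p q hp hq i|p q hq i].
- by rewrite coef0; exact: ideal0.
- by rewrite coefD; exact: idealD.
- by rewrite coefM; apply: ideal_sum => // j _; exact: idealM.
Qed.

Lemma mem_poly_idealC M c : ideal M -> poly_ideal M c%:P <-> M c.
Proof.
move=> iM; split=> [/(_ 0%N)|hc i]; first by rewrite coefC.
by rewrite coefC; case: eqP => // _; exact: ideal0.
Qed.

Lemma poly_idealS N M : N `<=` M -> poly_ideal N `<=` poly_ideal M.
Proof. by move=> h p hp i; exact: h. Qed.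

Lemma poly_ideal_sub M (E : set {poly R}) : ideal E ->
  (forall c, M c -> E c%:P) -> poly_ideal M `<=` E.
Proof.
move=> iE h p hp; rewrite -[p]coefK poly_def; apply: ideal_sum => // i _.
by rewrite -mul_polyC; apply: (ideal_mulr _ iE); exact: h.
Qed.

Lemma ideal_comapC (E : set {poly R}) : ideal E -> ideal [set c | E c%:P].
Proof.
move=> iE; split=> [|x y|x y] /=; rewrite ?polyC0 ?polyCD ?polyCM.
- exact: ideal0.
- exact: idealD.
- exact: idealM.
Qed.

Lemma poly_ideal_adjoins N w : ideal N ->
  poly_ideal (foldl adjoin N w) `<=`
    foldl adjoin (poly_ideal N) [seq x%:P | x <- w].
Proof.
move=> iN; have iE := ideal_adjoins [seq x%:P | x <- w] (ideal_poly_ideal iN).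
apply: poly_ideal_sub => //.
suff : foldl adjoin N w `<=` [set c | foldl adjoin (poly_ideal N)
    [seq x%:P | x <- w] c%:P] by [].
apply: adjoins_sub; first exact: ideal_comapC.
  by move=> c hc; apply: sub_adjoins; exact/mem_poly_idealC.
move=> x hx /=; apply: mem_adjoins; first exact: ideal_poly_ideal.
exact: map_f.
Qed.

Lemma poly_ideal_gen (w : seq R) :
  poly_ideal (ideal_gen [set` w]) = ideal_gen [set` [seq x%:P | x <- w]].
Proof.
have iw := ideal_ideal_gen [set` w]; apply/seteqP; split.
  have iE := ideal_ideal_gen [set` [seq x%:P | x <- w]].
  apply: poly_ideal_sub => //.
  suff : ideal_gen [set` w] `<=`
      [set c | ideal_gen [set` [seq x%:P | x <- w]] c%:P] by [].
  apply: ideal_gen_sub => [|x hx /=]; first exact: ideal_comapC.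
  by apply: mem_ideal_gen; exact: map_f.
apply: ideal_gen_sub; first exact: ideal_poly_ideal.
move=> _ /mapP[x hx ->]; apply/mem_poly_idealC => //; exact: mem_ideal_gen.
Qed.

Lemma poly_ideal_mul D E : ideal D -> ideal E ->
  poly_ideal (ideal_mul D E) `<=` ideal_mul (poly_ideal D) (poly_ideal E).
Proof.
move=> iD iE; have iDE := ideal_ideal_mul (poly_ideal D) (poly_ideal E).
apply: poly_ideal_sub => //.
suff : ideal_mul D E `<=`
    [set c | ideal_mul (poly_ideal D) (poly_ideal E) c%:P] by [].
apply: ideal_mul_sub => [|x y hx hy /=]; first exact: ideal_comapC.
by rewrite polyCM; apply: mem_ideal_mul; exact/mem_poly_idealC.
Qed.

(** If i and j are the least indices of coefficients of p and q outside P, the coefficient i + j of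
    p q is congruent to the product of these two modulo P. *)
Lemma prime_poly_ideal P : prime_ideal P -> prime_ideal (poly_ideal P).
Proof.
move=> [iP P1 hP]; split; first exact: ideal_poly_ideal.
  by rewrite -polyC1 => /mem_poly_idealC; auto.
move=> p q hpq; apply: contrapT => /not_orP[np nq].
have low (r : {poly R}) : ~ poly_ideal P r ->
    exists i, ~ P r`_i /\ forall j, (j < i)%N -> P r`_j.
  move=> /existsNP[i hi].
  have ex : exists i, `[< ~ P r`_i >] by exists i; apply/asboolP.
  case: (ex_minnP ex) => {hi}i /asboolP hi mi; exists i; split=> // j lji.
  by apply: contrapT => /asboolP /mi; rewrite leqNgt lji.
have [i [hi li]] := low _ np; have [j [hj lj]] := low _ nq.
suff /hP[] : P (p`_i * q`_j) by [].
have := hpq (i + j)%N; rewrite coefM.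
have lti : (i < (i + j).+1)%N by rewrite ltnS leq_addr.
rewrite (bigD1 (Ordinal lti)) //= addKn => h.
rewrite -[X in P X](addrK (\sum_(l < (i + j).+1 | l != Ordinal lti)
  p`_l * q`_(i + j - l))); apply: idealB => //.
rewrite big_mkcond; apply: ideal_sum => // l _; case: eqP => [_|/eqP nl] /=.
  exact: ideal0.
have /orP[lt|lt] : (l < i)%N || (i < l)%N by rewrite -neq_ltn.
  by apply: (ideal_mulr _ iP); exact: li.
apply: idealM => //; apply: lj; rewrite ltn_subLR ?ltn_add2r//.
by rewrite -ltnS.
Qed.

(* McCoy's theorem in a graded module, the coefficients of f having degree 1. *)
Lemma graded_mccoy (M : nat -> set R) f :
  (forall n, ideal (M n)) ->
  (forall i n x, M n x -> M n.+1 (f`_i * x)) ->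
  forall z n, poly_ideal (M n.+1) (f * z) ->
  forall i, exists k, poly_ideal (M (n + k)%N) (f`_i ^+ k *: z).
Proof.
move=> iM; elim/poly_ind: f => [|f c IH] hM z n hz i.
  by exists 1%N => j; rewrite coef0 expr0n scale0r coef0; exact: ideal0.
have hc k x : M k x -> M k.+1 (c * x).
  by have := hM 0%N k x; rewrite coefD coefMX coefC add0r.
have hf j k x : M k x -> M k.+1 (f`_j * x).
  by have := hM j.+1 k x; rewrite coefD coefMX coefC addr0.
have hck (k l : nat) x : M l x -> M (l + k)%N (c ^+ k * x).
  elim: k => [|k IHk] h; first by rewrite expr0 mul1r addn0.
  by rewrite addnS exprS -mulrA; exact/hc/IHk.
have coefF (u : {poly R}) l : ((f * 'X + c%:P) * u)`_l =
    (if l is l'.+1 then (f * u)`_l' else 0) + c * u`_l.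
  rewrite mulrDl coefD coefCM mulrAC coefMX; by case: l.
(* Say that k factors from degree 1 kill an element of degree n if the product lies in [M (n + k)].
   Solving coefficient l of the product for c z_l leaves a combination of the z_j with j < l, which
   c^l kills by induction. *)
have cz l : M (n + l.+1)%N (c ^+ l.+1 * z`_l).
  elim/ltn_ind: l => l IHl.
  have -> : c ^+ l.+1 * z`_l = c ^+ l * ((f * 'X + c%:P) * z)`_l -
      c ^+ l * (if l is l'.+1 then (f * z)`_l' else 0).
    by rewrite coefF mulrDr addrAC subrr add0r exprSr mulrA.
  apply: (idealB (iM _)).
    by rewrite addnS -addSn; exact: hck (hz l).
  case: l IHl => [|l] IHl; first by rewrite mulr0; exact: (ideal0 (iM _)).
  rewrite coefM mulr_sumr; apply: (ideal_sum (iM _)) => j _.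
  have ltj : (j <= l)%N by rewrite -ltnS.
  rewrite mulrCA addnS; apply: hf.
  have /IHl/(hck j) : (l - j < l.+1)%N by rewrite ltnS leq_subr.
  have e : (j + (l - j).+1 = l.+1)%N by rewrite addnS subnKC.
  by rewrite mulrA -exprD e -addnA [(_ + j)%N]addnC e.
have czl : poly_ideal (M (n + size z)%N) (c ^+ size z *: z).
  move=> l; rewrite coefZ; case: (ltnP l (size z)) => hl; last first.
    by rewrite nth_default// mulr0; exact: (ideal0 (iM _)).
  have := hck (size z - l.+1)%N _ _ (cz l).
  by rewrite mulrA -exprD subnK// -addnA subnKC.
case: i => [|i]; rewrite coefD coefMX coefC ?eqxx /= ?add0r ?addr0.
  by exists (size z).
(* Induction on an exponent q such that c^q kills z. Applied to c z in degree n + 1, it shows that c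
   kills some f_i^k z; then f kills it as well, and the induction on the polynomial applies. *)
move: (size z) czl => q {cz}; elim: q z n hz => [|q IHq] z n hz hq.
  by exists 0%N; move: hq; rewrite !expr0.
have [||k hk] := IHq (c *: z) n.+1.
- by move=> l; rewrite -scalerAr coefZ; exact/hc/hz.
- by rewrite scalerA -exprSr addSn -addnS.
have [|k' hk'] := IH hf (f`_i ^+ k *: z) (n + k)%N _ i.
  move=> l; have := coefF (f`_i ^+ k *: z) l.+1 => /= /(canLR (addrK _)) <-.
  apply: (idealB (iM _)).
    rewrite -scalerAr coefZ.
    have hfk (t : nat) x : M t x -> M (t + k)%N (f`_i ^+ k * x).
      elim: (k) => [|k1 IHk] h; first by rewrite expr0 mul1r addn0.
      by rewrite addnS exprS -mulrA; exact/hf/IHk.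
    by rewrite -addSn; apply: hfk; exact: hz.
  by have := hk l.+1; rewrite !coefZ mulrCA.
by exists (k + k')%N; rewrite addnA exprD mulrC -scalerA.
Qed.

Variable m : set R.
Hypothesis hloc : local_ring m.
Local Notation P := (poly_ideal m).

(** By McCoy's theorem for the constant family M, some power of each coefficient of s carries z into
    M[X], and one of these coefficients is a unit. *)
Lemma saturated_poly_ideal M : ideal M -> saturated P (poly_ideal M).
Proof.
move=> iM; split; first exact: ideal_poly_ideal.
move=> s z /existsNP[i /(local_unit hloc)[u hu]] hsz.
have [|k] := @graded_mccoy (fun=> M) s (fun=> iM) _ z 0%N hsz i.
  by move=> *; exact: idealM.
move=> h j; have := h j; rewrite coefZ => /(idealM (u ^+ k) iM).
by rewrite mulrA -exprMn hu expr1n mul1r.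
Qed.

Lemma chain_poly_ideal N M k : chain m N M k ->
  chain P (poly_ideal N) (poly_ideal M) k.
Proof.
elim: k M => [|k IH] M [[iM _] NM h]; (split; [exact: saturated_poly_ideal |
  exact: poly_idealS | ]) => //.
case: h => E [EM nE] c; exists (poly_ideal E); last exact: IH.
split=> [|h]; first exact: poly_idealS.
apply: nE => x /(mem_poly_idealC _ iM) /h hx.
by apply/mem_poly_idealC; first by case: (chain_saturated c).
Qed.

(** M / N is a vector space over R / m generated by at most h elements. These also generate M[X] /
    N[X], where m[X] kills them. *)
Lemma length_le_poly_ideal N M h : ideal N -> ideal M -> N `<=` M ->
  ideal_mul m M `<=` N -> length_le m N M h ->
  length_le P (poly_ideal N) (poly_ideal M) h.
Proof.
move=> iN iM NM mMN lN; have [w [sw wM hw]] := length_le_gens hloc iN iM NM lN.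
apply: (length_le_leq sw); rewrite -(size_map polyC).
have sN := saturated_poly_ideal iN; have sM := saturated_poly_ideal iM.
have pP := prime_poly_ideal (prime_max hloc).
apply: (length_le_adjoins pP sN sM); first exact: poly_idealS.
- by move=> _ /mapP[x /wM hx ->]; exact/mem_poly_idealC.
- move=> _ t /mapP[x /wM hx ->] ht i; rewrite mulrC mul_polyC coefZ mulrC.
  by apply: mMN; exact: mem_ideal_mul.
- move=> z hz; apply: (sub_saturation pP); apply: poly_ideal_adjoins => //.
  exact: poly_idealS hz.
Qed.

End PolynomialExtension.

(** * Reductions over R(X) *)

Section IdealPowers.
Variable T : comNzRingType.
Implicit Types (m D E : set T) (x y r t : T).

Lemma ideal_expS_mono D E n : D `<=` E -> ideal_exp D n `<=` ideal_exp E n.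
Proof.
move=> h; elim: n => // n IH; apply: ideal_mul_sub.
  exact: ideal_ideal_mul.
by move=> x y /h hx /IH hy; exact: mem_ideal_mul.
Qed.

(* The pigeonhole principle for monomials in w. *)
Lemma nilpotent_generators m (F : nat -> set T) (w : seq T) r d :
  ideal m -> (forall n, ideal (F n)) ->
  (forall n x r, m x -> F n r -> F n.+1 (x * r)) ->
  (forall x, x \in w -> m x) ->
  (forall x, x \in w -> exists k, F (d + k)%N (x ^+ k * r)) ->
  exists K, forall t, ideal_exp (ideal_gen [set` w]) K t -> F (d + K)%N (t * r).
Proof.
move=> im iF mF; have expF i j t y : ideal_exp m i t -> F j y -> F (i + j)%N (t * y).
  elim: i t y => [|i IH] t y ht hy; first by apply: (idealM _ (iF _)).
  have iE := ideal_colonr y (iF (i.+1 + j)%N).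
  apply: (ideal_mul_sub iE _ ht) => x z hx hz /=; rewrite -mulrA.
  by apply: mF => //; exact: IH.
elim: w => [|x u IH] wm hw.
  exists 1%N => t; rewrite (ideal_exp1 (ideal_ideal_gen _)) ideal_gen_seq /= => ->.
  by rewrite mul0r; exact: (ideal0 (iF _)).
have [||K hK] := IH.
- by move=> y hy; apply: wm; rewrite inE hy orbT.
- by move=> y hy; apply: hw; rewrite inE hy orbT.
have [k hk] := hw x (mem_head _ _); have mx := wm x (mem_head _ _).
set U := ideal_gen [set` u] in hK *; set W := ideal_gen _.
have Um : U `<=` m.
  by apply: ideal_gen_sub => // y hy; apply: wm; rewrite inE hy orbT.
(* The factors already sorted are in x^i and s; the q factors of t remain to be distributed between
   x and u. Once q is 0, either i is at least k or j is at least K. *)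
suff key q i j t s : (k + K <= i + j + q)%N -> ideal_exp W q t ->
    ideal_exp U j s -> F (d + (i + j + q))%N (x ^+ i * s * t * r).
  exists (k + K)%N => t ht; have := @key (k + K)%N 0%N 0%N t 1 (leqnn _) ht I.
  by rewrite expr0 !mul1r.
elim: q i j t s => [|q IHq] i j t s.
  rewrite addn0 => le _ hs.
  suff h : F (d + (i + j))%N (x ^+ i * s * r).
    by rewrite mulrAC; apply: (ideal_mulr _ (iF _)).
  have [ki|ik] := leqP k i.
    have -> : x ^+ i * s * r = (x ^+ (i - k) * s) * (x ^+ k * r).
      by rewrite mulrACA -exprD subnK// mulrA.
    have -> : (d + (i + j) = (i - k + j) + (d + k))%N.
      by rewrite [RHS]addnC -addnA [(k + _)%N]addnA subnKC.
    apply: expF => //; apply: mem_ideal_expD; first exact: mem_ideal_expX.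
    exact: ideal_expS_mono hs.
  have Kj : (K <= j)%N.
    by rewrite -(leq_add2l k); apply: leq_trans le _; rewrite leq_add2r ltnW.
  rewrite addnCA -mulrA; apply: (expF _ _); first exact: mem_ideal_expX.
  move: hs; rewrite -{1}(subnK Kj).
  apply: (ideal_expD_sub (ideal_colonr r (iF _))) => a b ha /hK hb.
  rewrite /mkset -(subnK Kj) addnCA -mulrA.
  by apply: (expF _ _) => //; exact: ideal_expS_mono ha.
move=> le ht hs; have iE1 := ideal_colonl (x ^+ i * s)
  (ideal_colonr r (iF (d + (i + j + q.+1))%N)).
apply: (ideal_mul_sub iE1 _ ht) => y z hy hz; rewrite /mkset mulrA.
have iE := ideal_colonl (x ^+ i * s)
  (ideal_colonr z (ideal_colonr r (iF (d + (i + j + q.+1))%N))).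
apply: (ideal_gen_sub iE _ hy) => {hy}y; rewrite /mkset.
rewrite inE => /orP[/eqP->|hy].
  have := IHq i.+1 j z s; rewrite addSn addSnnS => /(_ le hz hs).
  by rewrite exprSr -(mulrA _ x) (mulrC x) !mulrA.
have := IHq i j.+1 z (y * s); rewrite addnS addSnnS => /(_ le hz).
rewrite (mulrC y) mulrA; apply; rewrite mulrC; apply: mem_ideal_mul => //.
exact: mem_ideal_gen.
Qed.

End IdealPowers.

Local Arguments ideal_exp {R} I n : simpl never.

(** * The equality f m^N = m^(N+1) over R(X) for large N *)

Section ReductionPolynomial.
Variables (R : comNzRingType) (m : set R).
Hypothesis hloc : local_ring m.
Local Notation P := (poly_ideal m).
Let im : ideal m := ideal_max hloc.
Let pm : prime_ideal m := prime_max hloc.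
Let pP : prime_ideal P := prime_poly_ideal (prime_max hloc).
Local Notation mX n := (ideal_exp m n).
Let iX n : ideal (mX n) := ideal_ideal_exp m n.
Let sX n : saturated m (mX n) := local_saturated hloc (ideal_ideal_exp m n).

Lemma length_le_expS n : exists h, length_le m (mX n.+1) (mX n) h.
Proof. by apply: (length_le_fg hloc) => //; exact: ideal_expS. Qed.

Lemma length_le_exp i n : exists h, length_le m (mX (i + n)) (mX i) h.
Proof.
elim: n => [|n [h lh]].
  by rewrite addn0; apply: (length_le_fg hloc) => //; exact: ideal_mul_subr.
have [h' lh'] := length_le_expS (i + n); exists (h' + h)%N; rewrite addnS.
apply: (length_le_add pm _ _ _ lh' lh) => //; first exact: ideal_expS.
by apply: le_ideal_exp; exact: leq_addr.
Qed.

Lemma poly_dilate_mul (g : {poly R}) (D E : set R) : ideal D ->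
  poly_ideal E `<=` dilate P g (poly_ideal D) -> ideal E ->
  poly_ideal (ideal_mul m E) `<=` dilate P g (poly_ideal (ideal_mul m D)).
Proof.
move=> iD hE iE.
have iG := (saturated_dilate pP g (ideal_poly_ideal (ideal_ideal_mul m D))).1.
apply: poly_ideal_sub => //.
suff : ideal_mul m E `<=`
    [set c | dilate P g (poly_ideal (ideal_mul m D)) c%:P] by [].
apply: ideal_mul_sub; first exact: ideal_comapC.
move=> x y hx hy /=; have [s hs [u hu e]] : dilate P g (poly_ideal D) y%:P.
  by apply: hE; exact/mem_poly_idealC.
exists s => //; exists (x%:P * u); last by rewrite mulrCA e mulrCA polyCM.
by move=> i; rewrite coefCM; apply: mem_ideal_mul => //; exact: hu.
Qed.

Variables (a : R) (J : nat) (f : {poly R}).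
Hypothesis ma : m a.
Hypothesis a_reg : forall z, a * z = 0 -> z = 0.
Hypothesis a_param : mX J `<=` ideal_gen [set a].

(** The constant bounds the length of R / (a). Since a m^n lies in m^(n+1), the length in question
    is at most that of m^n / a m^n, which [length_le_dilate] compares with R / (a). *)
Lemma length_le_expS_bounded : exists c, forall n, length_le m (mX n.+1) (mX n) c.
Proof.
have ia := ideal_ideal_gen [set a]; have sa := local_saturated hloc ia.
have [c lc] : exists c, length_le m (ideal_gen [set a]) setT c.
  by have [c lc] := length_le_exp 0 J; exists c; exact: length_leS lc.
exists c => n k ck.
have [h lh] := length_le_exp 0 n.
have lc' : length_le m (dilate m a setT) setT c.
  apply: length_leS lc => // _ /ideal_gen1P[t ->]; rewrite mulrC.
  exact: (mem_dilate pm).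
apply: (length_le_dilate pm (sX n) (saturated_setT m) _ lh lc') => //.
apply: chain_subl ck; apply: saturation_sub; first exact: sX.
by move=> _ [z hz <-]; exact: mem_ideal_mul.
Qed.

Hypothesis f0 : f`_0 = a.
Hypothesis f_gen : m = ideal_gen [set` polyseq f].

Lemma coef_max i : m f`_i.
Proof.
have [lt|ge] := ltnP i (size f).
  by rewrite f_gen; apply: mem_ideal_gen; exact: mem_nth.
by rewrite nth_default//; exact: (ideal0 im).
Qed.

(** By McCoy's theorem for the zero family, a power of the coefficient a kills z, and a is
    regular. *)
Lemma poly_reg z : f * z = 0 -> z = 0.
Proof.
move=> fz; have [|||k] := @graded_mccoy _ (fun=> [set 0]) f _ _ z 0%N _ 0%N.
- move=> _; split=> // [x y|x y] /= ->; last by rewrite mulr0.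
  by move=> ->; rewrite addr0.
- by move=> i n x /= ->; rewrite mulr0.
- by move=> i; rewrite fz coef0.
rewrite f0 => hk; apply/polyP => i; rewrite coef0; have := hk i; rewrite coefZ /=.
by elim: k {hk} => [|k IH]; rewrite ?expr0 ?mul1r// exprS -mulrA => /a_reg.
Qed.

(* Together with membership in m^n, this defines the elements whose class in
   m^n / m^(n+1) is torsion in the associated graded ring. *)
Let ntor n : set R := [set r |
  forall x, x \in polyseq f -> exists k, mX (n.+1 + k) (x ^+ k * r)].

Let intor n : ideal (ntor n).
Proof.
split=> [x hx|x y kx ky z hz|x y ky z hz].
- by exists 0%N; rewrite mulr0; exact: (ideal0 (iX _)).
- have [k hk] := kx z hz; have [l hl] := ky z hz; exists (k + l)%N.
  have mz : m z by rewrite f_gen; exact: mem_ideal_gen.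
  rewrite mulrDr exprD; apply: (idealD (iX _)).
    rewrite [z ^+ k * _]mulrC -mulrA.
    have -> : (n.+1 + (k + l) = l + (n.+1 + k))%N by rewrite addnA addnC.
    by apply: mem_ideal_expD => //; exact: mem_ideal_expX.
  by rewrite -mulrA addnCA; apply: mem_ideal_expD => //; exact: mem_ideal_expX.
- have [k hk] := ky z hz; exists k; rewrite mulrCA; exact: (idealM _ (iX _)).
Qed.

Let tor n : set R := mX n `&` ntor n.

Let itor n : ideal (tor n).
Proof.
have ? := iX n; have ? := intor n.
split=> [|x y [? ?] [? ?]|x y [? ?]]; split.
- exact: ideal0.
- exact: (ideal0 (intor n)).
- exact: idealD.
- exact: (idealD (intor n)).
- exact: idealM.
- exact: (idealM _ (intor n)).
Qed.

Let sub_tor n : mX n.+1 `<=` tor n.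
Proof.
move=> r hr; split=> [|x _]; first exact: ideal_expS hr.
by exists 0%N; rewrite addn0 mul1r.
Qed.

Let coef_ntor i k x : ntor k x -> ntor k.+1 (f`_i * x).
Proof.
move=> hx y /hx[p hp]; exists p; rewrite mulrCA.
by apply: mem_ideal_mul => //; exact: coef_max.
Qed.

(** Injectivity of f on the associated graded ring modulo torsion. McCoy's theorem for [ntor] makes
    z torsion after multiplication by a power of each coefficient of f, so that z is torsion
    itself. *)
Let poly_tor n z : poly_ideal (mX n) z -> poly_ideal (tor n.+1) (f * z) ->
  poly_ideal (tor n) z.
Proof.
move=> hz hfz.
have hfM : poly_ideal (ntor n.+1) (f * z) by move=> l; case: (hfz l).
move=> l; split=> // x /(nthP 0)[i _ <-].
have [k hk] := graded_mccoy intor coef_ntor hfM i.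
have fi : f`_i \in polyseq f \/ f`_i = 0.
  case: (ltnP i (size f)) => h; [left | right]; first exact: mem_nth.
  exact: nth_default.
case: fi => [fi|->]; last first.
  by exists 1%N; rewrite mul0r; exact: (ideal0 (iX _)).
have [p] := hk l _ fi; rewrite coefZ mulrA -exprD => h.
by exists (p + k)%N; rewrite addnA addnAC addSn.
Qed.

(** The lengths of the m^n modulo torsion are bounded over R(X). At an n where the length is
    largest, the injection given by f is onto the next degree modulo torsion; a power of m removes
    the torsion, and Nakayama's lemma applies. *)
Lemma reduction_poly : exists N0, forall N, (N0 <= N)%N ->
  poly_ideal (mX N.+1) `<=` dilate P f (poly_ideal (mX N)).
Proof.
have ipX n := ideal_poly_ideal (iX n).
have spX n := saturated_poly_ideal hloc (iX n).
have ipt n := ideal_poly_ideal (itor n).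
have [c lc] := length_le_expS_bounded.
pose Q q := exists n, chain P (poly_ideal (tor n)) (poly_ideal (mX n)) q.
have exQ : exists q, `[< Q q >].
  exists 0%N; apply/asboolP; exists 0%N; exact: chain0.
have ubQ q : `[< Q q >] -> (q <= c)%N.
  move=> /asboolP[n cn].
  have := length_le_poly_ideal hloc (iX n.+1) (iX n) (@ideal_expS _ m n)
    (@subset_refl _ _) (lc n).
  by apply; apply: chain_subl cn; exact: poly_idealS.
case: (ex_maxnP exQ ubQ) => q /asboolP[n cn] maxq.
have iD : ideal (ideal_add [set f * z | z in poly_ideal (mX n)]
                  (poly_ideal (tor n.+1))).
  by apply: ideal_ideal_add => //; exact: ideal_image_mul.
(* Otherwise the image under f of a chain of length q in degree n could be prolonged by [mX n.+1],
   against the maximality of q. *)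
have step : poly_ideal (mX n.+1) `<=` saturation P
    (ideal_add [set f * z | z in poly_ideal (mX n)] (poly_ideal (tor n.+1))).
  apply: contrapT => nsub.
  have torf z : poly_ideal (tor n) z -> poly_ideal (tor n.+1) (f * z).
    move=> hz i; rewrite coefM; apply: (ideal_sum (itor _)) => j _.
    have [h1 h2] := hz (i - j)%N; split; last exact: coef_ntor.
    by apply: mem_ideal_mul => //; exact: coef_max.
  have cq := push_chain pP (ipt n.+1) torf (@poly_tor n) cn.
  have /asboolP/maxq : Q q.+1; last by rewrite ltnn.
  exists n.+1; apply: chain_rcons cq (spX _) _; split=> //.
  apply: saturation_sub; first exact: spX.
  apply: ideal_add_sub => //; last by apply: poly_idealS => r [].
  move=> _ [z hz <-] i; rewrite coefM; apply: (ideal_sum (iX _)) => j _.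
  by apply: mem_ideal_mul; [exact: coef_max | exact: hz].
(* As [tor n.+1] is finitely generated, a single power m^K kills the torsion of degree n + 1 in the
   associated graded ring. *)
have [K hK] : exists K, forall t r, mX K t -> tor n.+1 r -> mX (n.+2 + K) (t * r).
  have [w ew] := local_fg hloc (itor n.+1).
  have wt r : r \in w -> tor n.+1 r by rewrite ew; exact: mem_ideal_gen.
  have [K hK] : exists K, forall r, r \in w -> forall t, mX K t -> mX (n.+2 + K) (t * r).
    elim: (w) wt => [|r u IH] ut; first by exists 0%N.
    have [|K1 hK1] := IH.
      by move=> y hy; apply: ut; rewrite inE hy orbT.
    have [_ hr] := ut r (mem_head _ _).
    have [|||K2] := nilpotent_generators im (F := ideal_exp m) _ _ _ hr.
    - exact: iX.
    - by move=> *; exact: mem_ideal_mul.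
    - by move=> x hx; rewrite f_gen; exact: mem_ideal_gen.
    rewrite -f_gen => hK2; exists (K1 + K2)%N => y; rewrite inE => hy t.
    have iN := ideal_colonr y (iX (n.+2 + (K1 + K2))).
    case/orP: hy => [/eqP ey|hy]; last rewrite {1}addnC;
      apply: (ideal_expD_sub iN) => x z hx hz /=; rewrite -mulrA.
      by rewrite addnCA; apply: mem_ideal_expD => //; rewrite ey; exact: hK2.
    by rewrite [(K1 + _)%N]addnC addnCA; apply: mem_ideal_expD => //; exact: hK1.
  exists K => t r ht; rewrite ew => hr.
  suff : ideal_gen [set` w] `<=` [set r | mX (n.+2 + K) (t * r)] by apply.
  apply: ideal_gen_sub => [|y hy /=]; last exact: hK.
  exact: ideal_colonl.
(* Multiplying [step] by m^K gives m^(n+K+1) inside f m^(n+K) + m^(n+K+2) over R(X). *)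
have base : poly_ideal (mX (n + K).+1) `<=` dilate P f (poly_ideal (mX (n + K))).
  set N := (n + K)%N.
  have sfN : saturated P (dilate P f (poly_ideal (mX N))) by exact: saturated_dilate.
  have [w ew] := local_fg hloc (iX N.+1).
  rewrite ew poly_ideal_gen; apply: ideal_gen_sub; first by case: sfN.
  apply: (saturated_nakayama pP sfN); rewrite -poly_ideal_gen -ew.
  set E := saturation _ _.
  have iE : ideal E.
    apply: (saturated_saturation pP _).1; apply: ideal_ideal_add.
      by case: sfN.
    exact: ideal_ideal_mul.
  suff sub : mX N.+1 `<=` [set c | E c%:P].
    by move=> _ /mapP[x hx ->]; apply: sub; rewrite ew; exact: mem_ideal_gen.
  have -> : N.+1 = (K + n.+1)%N by rewrite addnS addnC.
  apply: ideal_expD_sub; first exact: ideal_comapC.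
  move=> t y ht hy /=; rewrite polyCM.
  have [s hs [_ [u hu <-] hsu]] : saturation P (ideal_add
      [set f * z | z in poly_ideal (mX n)] (poly_ideal (tor n.+1))) y%:P.
    by apply: step; exact/mem_poly_idealC.
  exists s => //; exists (t%:P * (f * u)).
    rewrite mulrCA; apply: (mem_dilate pP) => i; rewrite coefCM /N addnC.
    exact: mem_ideal_expD.
  rewrite mulrCA -mulrBr; apply: poly_ideal_mul => // i.
  rewrite coefCM; have := hK _ _ ht (hsu i).
  by rewrite !addSn.
exists (n + K)%N; elim=> [|N IH].
  by rewrite leqn0 => /eqP e; rewrite e in base.
rewrite leq_eqVlt => /orP[/eqP <-//|/IH hN].
exact: (poly_dilate_mul (iX N) hN (iX N.+1)).
Qed.

End ReductionPolynomial.

(** * Numerical invariants *)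

Section Invariants.
Variables (K : realType) (R : comNzRingType) (m : set R).
Hypothesis hloc : local_ring m.
Let pm : prime_ideal m := prime_max hloc.
Local Notation mX n := (ideal_exp m n).
Let iX n : ideal (mX n) := ideal_ideal_exp m n.

Lemma chain_seq (N M : set R) k : chain m N M k -> exists p : nat -> set R,
  [/\ forall i, (i <= k)%N -> ideal (p i) /\ N `<=` p i,
      forall i, (i < k)%N -> p i `<` p i.+1 & p k = M].
Proof.
elim: k M => [|k IH] M [[iM _] NM h]; first by exists (fun=> M).
case: h => E ltE /IH[p [hp sp pk]].
exists (fun i => if (i <= k)%N then p i else M); split=> [i|i|].
- by move=> _; case: leqP => // ik; exact: hp.
- rewrite ltnS => ik; rewrite ik; case: ltnP => [|ki]; first exact: sp.
  have -> : i = k by apply/eqP; rewrite eqn_leq ik ki.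
  by rewrite pk.
- by rewrite ltnn.
Qed.

Lemma seq_chain (N : set R) (p : nat -> set R) k :
  (forall i, (i <= k)%N -> ideal (p i) /\ N `<=` p i) ->
  (forall i, (i < k)%N -> p i `<` p i.+1) -> chain m N (p k) k.
Proof.
elim: k => [|k IH] hp sp.
  have [? ?] := hp 0%N isT; split=> //; exact: local_saturated.
have [ip Np] := hp k.+1 (leqnn _).
apply: chain_rcons (sp k (leqnn _)); last exact: local_saturated.
by apply: IH => i hi; [apply: hp; exact: ltnW | apply: sp; exact: ltnW].
Qed.

Lemma quotient_lengthE (J : set R) L : ideal J -> chain m J setT L ->
  length_le m J setT L -> quotient_length K J = (L%:R)%:E.
Proof.
move=> iJ cL lL; apply/eqP; rewrite eq_le; apply/andP; split.
  apply: ge_ereal_sup => _ [n [p [hp sp]] <-].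
  rewrite lee_fin ler_nat; apply: lL.
  by apply: chain_subr (seq_chain hp sp).
apply: ereal_sup_ubound; exists L => //.
by have [p [hp sp _]] := chain_seq cL; exists p.
Qed.

Lemma multiplicityE (h : nat -> nat) N e :
  (forall n, chain m (mX n.+1) (mX n) (h n)) ->
  (forall n, length_le m (mX n.+1) (mX n) (h n)) ->
  (forall n, (N <= n)%N -> h n = e) -> multiplicity K m = (e%:R)%:E.
Proof.
move=> ch lh he.
have qE n : quotient_length K (mX n) = ((\sum_(i < n) h i)%N%:R)%:E.
  have [c l] : chain m (mX n) setT (\sum_(i < n) h i) /\
      length_le m (mX n) setT (\sum_(i < n) h i).
    elim: n => [|n [c l]].
      rewrite big_ord0; split=> //; apply: (length_le_adjoins pm (w := [::])) => //.
      exact: sub_saturation.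
    rewrite big_ord_recr /= addnC; split; first exact: chain_cat (ch n) c.
    apply: (length_le_add pm (local_saturated hloc (iX n))) => //.
    exact: ideal_expS.
  exact: quotient_lengthE.
(* For n at least N, the length of R / m^n is C + n e; divided by n it tends to e. *)
pose C : K := (\sum_(i < N) h i)%N%:R - (N * e)%N%:R.
rewrite /multiplicity; apply/cvg_lim => //.
have : (fun n => ((C * n%:R^-1 + e%:R)%:E : \bar K)) @ \oo --> (e%:R)%:E.
  apply: cvg_EFin; first exact: nearW.
  rewrite -[X in _ --> X]add0r -(mulr0 C); apply: cvgD; last exact: cvg_cst.
  apply: cvgMl_tmp.
  by rewrite -(cvg_shiftS (fun n : nat => n%:R^-1 : K)); exact: cvg_harmonic.
apply: cvg_trans; apply: near_eq_cvg; near=> n.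
rewrite qE -EFinM; congr EFin.
have nN : (N <= n)%N by near: n; exact: nbhs_infty_ge.
have n0 : n%:R != 0 :> K.
  by rewrite pnatr_eq0 -lt0n; near: n; exact: nbhs_infty_gt.
have -> : (\sum_(i < n) h i = \sum_(i < N) h i + (n - N) * e)%N.
  rewrite -(big_mkord xpredT h) (big_cat_nat _ nN)//= big_mkord; congr (_ + _)%N.
  rewrite (eq_big_nat _ _ (F2 := fun=> e)); last by move=> i /andP[/he].
  by rewrite sum_nat_const_nat.
rewrite /C natrD mulnBl natrB ?leq_mul2r ?nN ?orbT// natrM addrCA.
by rewrite natrM [RHS]mulrDl (mulrAC n%:R) divff// mul1r [LHS]addrC.
Unshelve. all: by end_near.
Qed.

Lemma embdim_le (w : seq R) : m = ideal_gen [set` w] ->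
  (embdim K m <= (size w)%:R%:E)%E.
Proof. by move=> e; apply: ereal_inf_lbound; exists w. Qed.

(** A nonempty regular sequence starts with a regular element; if m contains none, its depth is at
    most 0. *)
Lemma depth_regular : depth K m = 1%:E ->
  exists2 s, m s & forall z, s * z = 0 -> z = 0.
Proof.
move=> d1; apply: contrapT => nreg.
have : (depth K m <= 0%:E)%E.
  apply: ge_ereal_sup => _ [[|s w] [sm [reg _]] <-]; first by rewrite lee_fin.
  exfalso; apply: nreg; exists s; first by apply: sm => /=; rewrite mem_head.
  move=> z hz; have := reg 0%N isT z; rewrite take0 /= hz ideal_gen_seq.
  by apply.
by rewrite d1 lee_fin ler10.
Qed.

End Invariants.

(** * Ulrich ideals *)

Section Ulrich.
Variables (R : comNzRingType) (m : set R).
Hypothesis hloc : local_ring m.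
Local Notation P := (poly_ideal m).
Let im : ideal m := ideal_max hloc.
Let pm : prime_ideal m := prime_max hloc.
Let pP : prime_ideal P := prime_poly_ideal (prime_max hloc).
Local Notation mX n := (ideal_exp m n).
Let iX n : ideal (mX n) := ideal_ideal_exp m n.

Definition regular (x : R) : Prop := forall z, x * z = 0 -> z = 0.

Lemma regularM x y : regular x -> regular y -> regular (x * y).
Proof. by move=> hx hy z; rewrite -mulrA => /hx/hy. Qed.

Lemma regularX x n : regular x -> regular (x ^+ n).
Proof.
move=> hx; elim: n => [|n IH]; first by move=> z; rewrite mul1r.
by rewrite exprS; exact: regularM.
Qed.

Lemma regular_neq0 x : regular x -> x <> 0.
Proof.
by move=> hx x0; have := hx 1; rewrite x0 mul0r => /(_ erefl)/eqP; rewrite oner_eq0.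
Qed.

(** The pigeonhole principle for generators of m, with the constant family I. *)
Lemma primary_exp I : primary_to m I -> exists n, mX n `<=` I.
Proof.
move=> [[iI _ _] rI]; have [w ew] := local_fg hloc im.
have [||||n hn] := @nilpotent_generators _ m (fun=> I) w 1 0%N im.
- by move=> _; exact: iI.
- by move=> _ x r _; exact: idealM.
- by move=> x hx; rewrite ew; exact: mem_ideal_gen.
- move=> x hx; have : m x by rewrite ew; exact: mem_ideal_gen.
  by rewrite -{1}rI => -[n hn]; exists n; rewrite mulr1.
by exists n => t; rewrite ew => /hn; rewrite mulr1.
Qed.

Lemma length_le_poly_exp i n : exists h,
  length_le P (poly_ideal (mX (i + n))) (poly_ideal (mX i)) h.
Proof.
have ipX k := ideal_poly_ideal (iX k).
have spX k := saturated_poly_ideal hloc (iX k).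
have XS k : mX k.+1 `<=` mX k by exact: ideal_expS.
elim: n => [|n [h lh]].
  exists 0%N; rewrite addn0.
  apply: (length_le_adjoins pP (w := [::])) => //; exact: sub_saturation.
have [h' lh'] := length_le_expS hloc (i + n); exists (h' + h)%N; rewrite addnS.
apply: (length_le_add pP _ _ _ _ lh) => //.
- exact: poly_idealS.
- by apply: poly_idealS; apply: le_ideal_exp; exact: leq_addr.
- exact: (length_le_poly_ideal hloc).
Qed.

(** * The modules m^j I for an Ulrich ideal I, where B represents a basis of I / I^2 *)

Section Structure.
Variables (f : {poly R}) (I : set R) (a : R) (B : seq R).
Hypothesis fm : forall i, m f`_i.
Hypothesis f_reg : forall z, f * z = 0 -> z = 0.
Hypothesis f_red : poly_ideal (mX 2) `<=` dilate P f (poly_ideal (mX 1)).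
Hypotheses (iI : ideal I) (Im : I `<=` m) (Ia : I a) (a_reg : regular a).
Hypothesis I_neq : I <> ideal_gen [set a].
Hypothesis I_sq : ideal_exp I 2 = ideal_mul (ideal_gen [set a]) I.
Hypotheses (uB : uniq B) (BI : forall x, x \in B -> I x).
Hypothesis B_gen : forall y, I y ->
  exists c : R -> R, ideal_exp I 2 (y - \sum_(x <- B) c x * x).
Hypothesis B_free : forall c : R -> R, ideal_exp I 2 (\sum_(x <- B) c x * x) ->
  forall x, x \in B -> I (c x).
Local Notation I2 := (ideal_exp I 2).

Let iI2 : ideal I2 := ideal_ideal_exp I 2.

Lemma mem_sq x y : I x -> I y -> I2 (x * y).
Proof. by move=> hx hy; apply: mem_ideal_mul => //; exact: mem_ideal_exp1. Qed.

Lemma sq_sub N : ideal N -> (forall y, I y -> N (a * y)) -> I2 `<=` N.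
Proof.
move=> iN h; rewrite I_sq; apply: ideal_mul_sub => // _ y /ideal_gen1P[t ->] hy.
by rewrite -mulrA; apply: idealM => //; exact: h.
Qed.

(** If all coefficients of a were in m, then I^2 = a I would lie in m I^2 and vanish by Nakayama's
    lemma, although it contains the regular element a^2. *)
Lemma coef_unit (c : R -> R) : I2 (a - \sum_(x <- B) c x * x) ->
  exists2 b, b \in B & ~ m (c b).
Proof.
move=> hc; apply: contrapT => nex.
have mc x : x \in B -> m (c x).
  by move=> hx; apply: contrapT => nm; apply: nex; exists x.
have i0 : ideal [set 0 : R].
  by split=> // [x y|x y] /= ->; [move=> ->; rewrite addr0 | rewrite mulr0].
suff /(local_nakayama hloc i0 iI2) h0 : I2 `<=` ideal_add [set 0] (ideal_mul m I2).
  by apply: (regular_neq0 (regularM a_reg a_reg)); apply: h0; exact: mem_sq.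
have imI2 := ideal_ideal_mul m I2.
suff sub : I2 `<=` ideal_mul m I2 by move=> z /sub; exact: ideal_addr.
apply: sq_sub => // y hy; rewrite -(subrK (\sum_(x <- B) c x * x) a) mulrDl.
apply: (idealD imI2); last first.
  rewrite mulr_suml; apply: (ideal_sum imI2) => x hx; rewrite -mulrA.
  by apply: mem_ideal_mul; [exact: mc | apply: mem_sq => //; exact: BI].
by rewrite mulrC; apply: mem_ideal_mul => //; exact: Im.
Qed.

(* I contains the socle (a) : m of R / (a), since I / (a) is a nonzero free
   R / I-module. *)
Lemma colon_sub x : (forall z, m z -> ideal_gen [set a] (x * z)) -> I x.
Proof.
move=> hx; have [c hc] := B_gen Ia; have [b hb ncb] := coef_unit hc.
have [v hv] := local_unit hloc ncb.
(* With b as the only basis element, I would be generated by a modulo m I, as [c b] is a unit, and I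
   = (a) by Nakayama's lemma. *)
have [b' hb' neq] : exists2 b', b' \in B & b' != b.
  apply: contrapT => nex.
  have eB x' : x' \in B -> x' = b.
    by move=> h; apply/eqP; apply: contrapT => /negP ne; apply: nex; exists x'.
  have sumB (d : R -> R) : \sum_(x <- B) d x * x = d b * b.
    rewrite (bigD1_seq b)//= big_seq_cond big1 ?addr0// => y /andP[/eB ->].
    by rewrite eqxx.
  have ia := ideal_ideal_gen [set a].
  apply: I_neq; apply/seteqP; split; last first.
    by apply: ideal_gen_sub => // _ ->.
  apply: (local_nakayama hloc ia iI) => y hy.
  have [d hd] := B_gen hy; rewrite !sumB in hc hd.
  exists (d b * v * a).
    by apply: (idealM _ ia); apply: sub_ideal_gen.
  have sqm : I2 `<=` ideal_mul m I.
    apply: sq_sub; first exact: ideal_ideal_mul.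
    by move=> z hz; apply: mem_ideal_mul => //; exact: Im.
  apply: sqm; have -> : y - d b * v * a =
      (y - d b * b) - d b * v * (a - c b * b).
    have e1 : d b * v * (c b * b) = d b * b by rewrite -mulrA (mulrA v) hv mul1r.
    by rewrite [in RHS]mulrBr e1 opprB addrA subrK.
  by apply: (idealB iI2) => //; exact: (idealM _ iI2).
(* Replacing a by its expansion turns x b' = r a into a relation modulo I^2. Its coefficient at b
   puts r in I, since [c b] is a unit; its coefficient at b' then puts x in I. *)
have [r hr] : exists r, x * b' = r * a.
  by have /ideal_gen1P := hx b' (Im (BI hb')).
have h : I2 (\sum_(y <- B) (r * c y - (if y == b' then x else 0)) * y).
  have -> : \sum_(y <- B) (r * c y - (if y == b' then x else 0)) * y =
      - (r * (a - \sum_(y <- B) c y * y)).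
    rewrite mulrBr -hr mulr_sumr opprB.
    have -> : x * b' = \sum_(y <- B) (if y == b' then x else 0) * y.
      rewrite (bigD1_seq b')//= eqxx big1 ?addr0// => y /negPf ->.
      by rewrite mul0r.
    by rewrite -sumrB; apply: eq_bigr => y _; rewrite mulrBl mulrA.
  by apply: (idealN iI2); exact: (idealM _ iI2).
have := B_free h hb; rewrite eq_sym (negPf neq) subr0 => hrc.
have Ir : I r by rewrite -[r]mulr1 -hv mulrCA; exact: idealM.
have := B_free h hb'; rewrite eqxx => h'.
rewrite -[x](subKr (r * c b')); apply: idealB => //; exact: ideal_mulr.
Qed.

(** Let x be in m and y in I. Over R(X), m^2 = f m gives a x = f w, and z x = f w' for every z in m;
    cancelling f yields z w = a w', so that w has coefficients in (a) : m, hence in I. Then w y = a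
    u with u in I[X], because I^2 = a I, and cancelling a yields x y = f u. *)
Lemma poly_max_mul : poly_ideal (ideal_mul m I) `<=` dilate P f (poly_ideal I).
Proof.
have iD := (saturated_dilate pP f (ideal_poly_ideal iI)).1.
apply: poly_ideal_sub => //.
suff : ideal_mul m I `<=` [set c | dilate P f (poly_ideal I) c%:P] by [].
apply: ideal_mul_sub; first exact: ideal_comapC.
move=> x y mx Iy; rewrite /mkset polyCM.
have red u v : m u -> m v -> exists s w, [/\ ~ P s, poly_ideal m w &
    f * w = s * (u * v)%:P].
  move=> mu mv; have [|s hs [w hw e]] := f_red (_ : poly_ideal (mX 2) (u * v)%:P).
    apply/mem_poly_idealC; first exact: iX.
    by apply: mem_ideal_mul => //; exact: mem_ideal_exp1.
  by exists s, w; split=> //; rewrite ideal_exp1 in hw.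
have [s [w [hs hw e]]] := red _ _ (Im Ia) mx.
have ia := ideal_ideal_gen [set a].
have wI : poly_ideal I w.
  move=> i; apply: colon_sub => z mz.
  have [s' [w' [hs' hw' e']]] := red _ _ mz mx.
  have e2 : s' * (z%:P * w) = s * (a%:P * w').
    apply/eqP; rewrite -subr_eq0; apply/eqP; apply: f_reg.
    rewrite mulrBr mulrCA [f * (z%:P * w)]mulrCA e [f * (s * _)]mulrCA.
    rewrite [f * (a%:P * w')]mulrCA e' !polyCM; apply/eqP; rewrite subr_eq0.
    apply/eqP; rewrite [z%:P * (s * _)]mulrCA [s' * (s * _)]mulrCA.
    by rewrite [z%:P * (a%:P * _)]mulrCA [s' * (a%:P * _)]mulrCA.
  have [_ sa] := saturated_poly_ideal hloc ia.
  have /(_ i) : poly_ideal (ideal_gen [set a]) (z%:P * w).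
    apply: sa hs' _; rewrite e2; apply: (idealM _ (ideal_poly_ideal ia)).
    move=> l; rewrite coefCM mulrC.
    by apply: (idealM _ ia); apply: sub_ideal_gen.
  by rewrite coefCM mulrC.
have [u [hu eu]] : exists u, poly_ideal I u /\ w * y%:P = a%:P * u.
  have hq l : exists t, I t /\ w`_l * y = a * t.
    have : I2 (w`_l * y) by exact: mem_sq.
    have iE : ideal [set z | exists t, I t /\ z = a * t].
      split=> [|_ _ [t [It ->]] [t' [It' ->]]|z _ [t [It ->]]].
      - by exists 0; split; [exact: ideal0 | rewrite mulr0].
      - by exists (t + t'); split; [exact: idealD | rewrite mulrDr].
      - by exists (z * t); split; [exact: idealM | rewrite mulrCA].
    by apply: (sq_sub iE) => t It; exists t.
  have [t ht] := choice hq.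
  exists (\poly_(l < size w) t l); split.
    by move=> l; rewrite coef_poly; case: ifP => _; [case: (ht l) | exact: ideal0].
  apply/polyP => l; rewrite coefMC coefCM coef_poly; case: ltnP => h.
    by case: (ht l).
  by rewrite nth_default// mul0r mulr0.
exists s => //; exists u => //.
have aP_reg (p : {poly R}) : a%:P * p = 0 -> p = 0.
  move=> h; apply/polyP => l; rewrite coef0; apply: a_reg.
  by rewrite -coefCM h coef0.
apply/eqP; rewrite -subr_eq0; apply/eqP; apply: aP_reg.
rewrite mulrBr mulrCA -eu mulrA e polyCM; apply/eqP; rewrite subr_eq0; apply/eqP.
by rewrite [RHS]mulrCA !mulrA.
Qed.

Local Notation mI j := (iter j (ideal_mul m) I).

Let imI j : ideal (mI j).
Proof. by case: j => [|j] //; exact: ideal_ideal_mul. Qed.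

Lemma mem_iter_mul j y b : mX j y -> I b -> mI j (y * b).
Proof.
elim: j y => [|j IH] y hy hb; first exact: idealM.
apply: (ideal_mul_sub (ideal_colonr b (imI j.+1)) _ hy) => x z hx hz.
by rewrite /mkset -mulrA; apply: mem_ideal_mul => //; exact: IH.
Qed.

Lemma iter_mul_sub j N : ideal N -> (forall y b, mX j y -> I b -> N (y * b)) ->
  mI j `<=` N.
Proof.
elim: j N => [|j IH] N iN h; first by move=> x hx; rewrite -[x]mul1r; exact: h.
apply: ideal_mul_sub => // x y hx hy.
apply: (IH _ (ideal_colonl x iN) _ y hy) => z b hz hb; rewrite /mkset mulrA.
by apply: h => //; exact: mem_ideal_mul.
Qed.

Lemma iter_mulS j : mI j.+1 `<=` mI j.
Proof. by apply: ideal_mul_subr; exact: imI. Qed.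

(** B generates I / m I. Over R(X), f maps m^j I onto m^(j+1) I, so the length of m^j I / m^(j+1) I
    does not increase with j. *)
Lemma length_le_iter_mul j : length_le m (mI j.+1) (mI j) (size B).
Proof.
have spI k := saturated_poly_ideal hloc (imI k).
suff h : length_le P (poly_ideal (mI j.+1)) (poly_ideal (mI j)) (size B).
  by move=> k ck; apply: h; exact: (chain_poly_ideal hloc).
have fI k : poly_ideal (mI k.+1) `<=` dilate P f (poly_ideal (mI k)).
  elim: k => [|k IH]; first exact: poly_max_mul.
  exact: (poly_dilate_mul hloc (imI k) IH (imI k.+1)).
elim: j => [|j IH].
  apply: (length_le_poly_ideal hloc (imI 1%N) (imI 0%N)) => //.
    exact: (@iter_mulS 0).
  have sI k := local_saturated hloc (imI k).
  apply: (length_le_adjoins pm (sI 1%N) (sI 0%N)) => //.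
  - exact: (@iter_mulS 0).
  - by move=> x t hx ht; apply: mem_ideal_mul => //; exact: BI.
  - move=> y hy; apply: (sub_saturation pm).
    have [c hc] := B_gen hy; have iA := ideal_adjoins B (imI 1%N).
    rewrite -(subrK (\sum_(x <- B) c x * x) y); apply: idealD => //; last first.
      by apply: ideal_sum => // x hx; apply: idealM => //; exact: mem_adjoins.
    apply: sub_adjoins; move: hc; apply: (sq_sub (imI 1%N)) => z hz.
    by apply: mem_ideal_mul => //; exact: Im.
move=> k ck; apply: IH; apply: (pull_chain (spI j.+1) (spI j) _ _ (fI j)) ck.
  by apply: poly_idealS; exact: iter_mulS.
move=> z hz i; rewrite coefM; apply: ideal_sum => // l _.
by apply: mem_ideal_mul; [exact: fm | exact: hz].
Qed.

(** Modulo I^2, an element of m^j I is a combination of B with coefficients in m^j, and freeness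
    determines the coefficients modulo I. *)
Lemma coef_iter_mul j (d : R -> R) z : mI j z ->
  I2 (\sum_(x <- B) d x * x - z) -> forall x, x \in B ->
  ideal_add I (mX j) (d x).
Proof.
move=> hz hd.
pose E := [set z | exists2 c : R -> R, (forall x, mX j (c x)) &
                     I2 (z - \sum_(x <- B) c x * x)].
have iE : ideal E.
  split=> [|y y' [c hc h] [c' hc' h']|y y' [c hc h]].
  - exists (fun=> 0); first by move=> _; exact: (ideal0 (iX j)).
    by rewrite big1 ?subr0; [exact: ideal0 | move=> i _; rewrite mul0r].
  - exists (fun x => c x + c' x); first by move=> x; exact: (idealD (iX j)).
    under eq_bigr do rewrite mulrDl.
    by rewrite big_split opprD addrACA; exact: (idealD iI2).
  - exists (fun x => y * c x); first by move=> x; exact: (idealM _ (iX j)).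
    under eq_bigr do rewrite -mulrA.
    by rewrite -mulr_sumr -mulrBr; exact: (idealM _ iI2).
have [c hc h] : E z.
  apply: (iter_mul_sub iE _ hz) => y b hy /B_gen[c hc].
  exists (fun x => y * c x); first by move=> x; exact: (ideal_mulr _ (iX j)).
  under eq_bigr do rewrite -mulrA.
  by rewrite -mulr_sumr -mulrBr; exact: (idealM _ iI2).
move=> x hx; exists (d x - c x); last by rewrite subKr; exact: hc.
apply: (B_free (c := fun x => d x - c x)) => //.
under eq_bigr do rewrite mulrBl.
by rewrite sumrB -(subrK z (\sum_(x <- B) d x * x)) -addrA; exact: (idealD iI2).
Qed.

(** The products of y with B are independent: a relation with a unit coefficient would put y in I +
    m^(j+1), by [coef_iter_mul]. Their number is the bound on the length. *)
Lemma basis_iter_mul j y : mX j y -> ~ ideal_add I (mX j.+1) y ->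
  forall u, mI j u -> exists c : R -> R,
    mI j.+1 (u - \sum_(x <- B) c x * (y * x)).
Proof.
move=> hy ny; apply: (length_le_basis hloc) => //.
- exact: iter_mulS.
- exact: length_le_iter_mul.
- by move=> x hx; apply: mem_iter_mul => //; exact: BI.
move=> c hc x hx; apply: contrapT => /(local_unit hloc)[v hv]; apply: ny.
have iA := ideal_ideal_add iI (iX j.+1).
have := coef_iter_mul (d := fun x => c x * y) hc _ hx.
under eq_bigr do rewrite -mulrA.
rewrite subrr => /(_ (ideal0 iI2)) /(idealM v iA).
by rewrite mulrA hv mul1r.
Qed.

(** For a basis element b, expand t b in the products of y with B and compare the coefficients at
    b. *)
Lemma principal_mod j y : mX j y -> ~ ideal_add I (mX j.+1) y ->
  forall t, mX j t -> exists c, ideal_add I (mX j.+1) (t - c * y).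
Proof.
move=> hy ny t ht.
have [c0 /coef_unit[b hb _]] := B_gen Ia.
have [c hc] := basis_iter_mul hy ny (mem_iter_mul ht (BI hb)).
exists (c b).
have := coef_iter_mul (d := fun x => (if x == b then t else 0) - c x * y) hc _ hb.
rewrite eqxx; apply; rewrite (_ : \sum_(x <- B) _ = t * b -
    \sum_(x <- B) c x * (y * x)) ?subrr; first exact: ideal0.
under eq_bigr do rewrite mulrBl -mulrA.
rewrite sumrB (bigD1_seq b)//= eqxx big1 ?addr0// => x /negPf ->.
by rewrite mul0r.
Qed.

(** Induction on j. By Nakayama's lemma some y in m^(j+1) is outside I + m^(j+2). Expand u in I^2 in
    the products of y with B: as u vanishes in I / I^2, a unit coefficient would put y in I +
    m^(j+2). Hence all coefficients are in m. *)
Lemma sq_sub_iter j : ~ (mX j `<=` I) -> I2 `<=` mI j.+1.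
Proof.
elim: j => [|j IH] nj.
  apply: sq_sub; first exact: (imI 1%N).
  by move=> z hz; apply: mem_ideal_mul => //; exact: Im.
have {}IH : I2 `<=` mI j.+1.
  by apply: IH => h; apply: nj; apply: subset_trans h; exact: ideal_expS.
have [y hy ny] : exists2 y, mX j.+1 y & ~ ideal_add I (mX j.+2) y.
  apply: contrapT => nex; apply: nj; apply: (local_nakayama hloc iI (iX _)).
  by move=> y hy; apply: contrapT => ny; apply: nex; exists y.
move=> u hu; have [c hc] := basis_iter_mul hy ny (IH u hu).
rewrite -(subrK (\sum_(x <- B) c x * (y * x)) u).
apply: (idealD (imI j.+2)) => //; apply: (ideal_sum (imI j.+2)) => x hx.
have iA := ideal_ideal_add iI (iX j.+2).
apply: mem_ideal_mul; last exact: (@mem_iter_mul j.+1 _ _ hy (BI hx)).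
apply: contrapT => /(local_unit hloc)[v hv]; apply: ny.
have := coef_iter_mul (d := fun x => - (c x * y)) hc _ hx.
have -> : \sum_(x <- B) - (c x * y) * x = - \sum_(x <- B) c x * (y * x).
  by rewrite -sumrN; apply: eq_bigr => z _; rewrite mulNr mulrA.
rewrite opprB addrA addNr sub0r => /(_ (idealN iI2 hu)) /(idealM (- v) iA).
by rewrite mulrNN mulrA hv mul1r.
Qed.

End Structure.
End Ulrich.

(** * Comparison of two Ulrich ideals *)

Section UlrichIdeals.
Variables (R : comNzRingType) (m : set R).
Hypothesis hloc : local_ring m.
Local Notation P := (poly_ideal m).
Local Notation mX n := (ideal_exp m n).
Let iX n : ideal (mX n) := ideal_ideal_exp m n.

(** As I is finitely generated, finitely many elements of a given basis already span I / N. *)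
Lemma free_quotient_basis (I N : set R) : ideal I -> ideal N -> N `<=` I ->
  free_quotient I I N -> exists B : seq R,
  [/\ uniq B, (forall x, x \in B -> I x),
    (forall y, I y -> exists c : R -> R, N (y - \sum_(x <- B) c x * x)) &
    (forall c : R -> R, N (\sum_(x <- B) c x * x) ->
       forall x, x \in B -> I (c x))].
Proof.
move=> iI iN NI [B0 [B0I gen free]].
pose span B := [set y | exists c : R -> R, N (y - \sum_(x <- B) c x * x)].
have ispan B : ideal (span B).
  split=> [|y y' [c h] [c' h']|y y' [c h]].
  - exists (fun=> 0); rewrite big1 ?subr0; first exact: ideal0.
    by move=> i _; rewrite mul0r.
  - exists (fun x => c x + c' x); under eq_bigr do rewrite mulrDl.
    by rewrite big_split opprD addrACA; exact: idealD.
  - exists (fun x => y * c x); under eq_bigr do rewrite -mulrA.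
    by rewrite -mulr_sumr -mulrBr; exact: idealM.
have Nspan B : N `<=` span B.
  move=> y hy; exists (fun=> 0); rewrite big1 ?subr0// => i _.
  by rewrite mul0r.
have mem_span B x : uniq B -> x \in B -> span B x.
  move=> uB hx; exists (fun y => if y == x then 1 else 0).
  rewrite (bigD1_seq x)//= eqxx mul1r big1 ?addr0 ?subrr; first exact: ideal0.
  by move=> y /negPf ->; rewrite mul0r.
have [w ew] := local_fg hloc iI.
have [B [uB BB0 hB]] : exists B : seq R, [/\ uniq B, [set` B] `<=` B0 &
    forall y, y \in w -> span B y].
  have wI y : y \in w -> I y by rewrite ew; exact: mem_ideal_gen.
  elim: (w) wI => [|y u IH] uI; first by exists [::].
  have [|B [uB BB0 hB]] := IH.
    by move=> z hz; apply: uI; rewrite inE hz orbT.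
  have [s [c [sB0 hs]]] := gen y (uI y (mem_head _ _)).
  exists (undup (s ++ B)); split; first exact: undup_uniq.
    by move=> z /=; rewrite mem_undup mem_cat => /orP[/sB0|/BB0].
  have hsub x : x \in s ++ B -> span (undup (s ++ B)) x.
    by move=> hx; apply: mem_span; rewrite ?undup_uniq ?mem_undup.
  move=> z; rewrite inE => /orP[/eqP->|/hB[d hd]].
    rewrite -(subrK (\sum_(x <- s) c x * x) y); apply: (idealD (ispan _)).
      exact: Nspan.
    apply: (ideal_sum (ispan _)) => x hx; apply: (idealM _ (ispan _)).
    by apply: hsub; rewrite mem_cat hx.
  rewrite -(subrK (\sum_(x <- B) d x * x) z); apply: (idealD (ispan _)).
    exact: Nspan.
  apply: (ideal_sum (ispan _)) => x hx; apply: (idealM _ (ispan _)).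
  by apply: hsub; rewrite mem_cat hx orbT.
exists B; split=> //.
- by move=> x /BB0/B0I.
- suff : I `<=` span B by [].
  by rewrite ew; apply: ideal_gen_sub => // y /hB.
- by move=> c hc x hx; exact: (free B c uB BB0 hc).
Qed.

Lemma primary_sub I : primary_to m I -> I `<=` m.
Proof. by move=> [_ <-] x hx; exists 1%N. Qed.

Variables (f : {poly R}).
Hypothesis fm : forall i, m f`_i.
Hypothesis f_reg : forall z, f * z = 0 -> z = 0.
Hypothesis f_red : poly_ideal (mX 2) `<=` dilate P f (poly_ideal (mX 1)).
Hypothesis m_reg : exists2 s, m s & regular s.

(** A power of a regular element of m is a multiple of a. *)
Lemma parameter_regular a : primary_to m (ideal_gen [set a]) -> regular a.
Proof.
move=> [_ ra] z az; have [s ms s_reg] := m_reg.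
move: ms; rewrite -ra => -[n /ideal_gen1P[t e]].
have sn_reg : regular (s ^+ n) by exact: regularX.
by apply: sn_reg; rewrite e -mulrA az mulr0.
Qed.

Lemma ulrich_structure I : ulrich_ideal m I ->
  [/\ ideal I, I `<=` m, exists2 a, I a & regular a,
     forall j, ~ (mX j `<=` I) ->
       ideal_exp I 2 `<=` iter j.+1 (ideal_mul m) I &
     forall j y, mX j y -> ~ ideal_add I (mX j.+1) y ->
       forall t, mX j t -> exists c, ideal_add I (mX j.+1) (t - c * y)].
Proof.
move=> [prI [a /= [prQ [QI _] neq sq free]]].
have iI : ideal I by case: prI => [[]].
have Im := primary_sub prI.
have Ia : I a by apply: QI; apply: sub_ideal_gen.
have a_reg := parameter_regular prQ.
have I2I : ideal_exp I 2 `<=` I.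
  apply: subset_trans (@ideal_expS _ I 1) _; rewrite ideal_exp1//.
have [B [uB BI Bg Bf]] := free_quotient_basis iI (ideal_ideal_exp I 2) I2I free.
split=> //; first by exists a.
- exact: (sq_sub_iter hloc fm f_reg f_red iI Im Ia a_reg neq sq uB BI Bg Bf).
- exact: (principal_mod hloc fm f_reg f_red iI Im Ia a_reg neq sq uB BI Bg Bf).
Qed.

Lemma ulrich_sub I J : ulrich_ideal m I -> ulrich_ideal m J ->
  (forall j, mX j `<=` J -> mX j `<=` I) -> J `<=` I.
Proof.
move=> uI uJ hIJ y Jy; apply: contrapT => nIy.
have [n hn] := primary_exp hloc (proj1 uI).
have [iI Im [a Ia a_reg] sqI pI] := ulrich_structure uI.
have [iJ Jm [b Jb b_reg] sqJ _] := ulrich_structure uJ.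
(* Such a j exists because a power of m lies in I, while y does not. *)
have [j hj nj] : exists2 j, ideal_add I (mX j) y & ~ ideal_add I (mX j.+1) y.
  apply: contrapT => nex.
  have all_j k : ideal_add I (mX k) y.
    elim: k => [|k IH]; first by exists 0; [exact: ideal0 |].
    by apply: contrapT => h; apply: nex; exists k.
  by apply: nIy; apply: (ideal_add_sub iI _ hn (all_j n)).
have iA k := ideal_ideal_add iI (iX k).
have [i Ii hyi] := hj.
(* The element y - i of m^j generates m^j modulo I + m^(j+1); it differs from y in J by i in I. *)
have nyi : ~ ideal_add I (mX j.+1) (y - i).
  move=> h; apply: nj; rewrite -(subrK i y); apply: (idealD (iA _)) => //.
  by apply: ideal_addl.
have nXI : ~ (mX j `<=` I).
  by move=> h; apply: nIy; rewrite -(subrK i y); apply: idealD => //; exact: h.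
have nXJ : ~ (mX j `<=` J) by move=> /hIJ.
have {}sqI := sqI j nXI; have {}sqJ := sqJ j nXJ.
pose IJ := ideal_mul I J; pose E := ideal_mul (mX j) IJ.
have iE : ideal E by exact: ideal_ideal_mul.
have imE := ideal_ideal_mul m E.
have mXE t u v : mX j.+1 t -> I u -> J v -> ideal_mul m E (t * (u * v)).
  move=> ht hu hv.
  apply: (ideal_mul_sub (ideal_colonr (u * v) imE) _ ht) => x z hx hz.
  rewrite /mkset -mulrA; apply: mem_ideal_mul => //; apply: mem_ideal_mul => //.
  exact: mem_ideal_mul.
have hE : E `<=` ideal_mul m E.
  apply: ideal_mul_sub => // t uv ht huv.
  apply: (ideal_mul_sub (ideal_colonl t imE) _ huv) => u v hu hv; rewrite /mkset.
  have [c [i' Ii' ht']] := pI j _ hyi nyi t ht.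
  (* This splits t into parts in m^(j+1), I and J. Multiplied by u v, they fall into m^(j+1) I J
     directly, through I^2 in m^(j+1) I, and through J^2 in m^(j+1) J. *)
  have -> : t * (u * v) = (t - c * (y - i) - i') * (u * v) +
      (i' - c * i) * u * v + c * (y * v) * u.
    rewrite -[in RHS](mulrA _ u v) -mulrDl.
    have -> : c * (y * v) * u = c * y * (u * v).
      by rewrite -!mulrA (mulrC v u).
    rewrite -mulrDl; congr (_ * _).
    rewrite [X in _ = X + _]addrA subrK mulrBr opprB [t + _]addrA addrAC.
    by rewrite addrK subrK.
  apply: (idealD imE); first apply: (idealD imE).
  - exact: mXE.
  - have : ideal_exp I 2 ((i' - c * i) * u).
      by apply: mem_sq => //; apply: idealB => //; exact: idealM.
    move=> /sqI; apply: (iter_mul_sub (ideal_colonr v imE)) => s w hs hw.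
    by rewrite /mkset -mulrA; exact: mXE.
  - rewrite mulrAC; rewrite -mulrA; apply: (idealM _ imE).
    have : ideal_exp J 2 (y * v) by exact: mem_sq.
    move=> /sqJ; apply: (iter_mul_sub (ideal_colonl u imE)) => s w hs hw.
    by rewrite /mkset mulrCA; exact: mXE.
have i0 : ideal [set 0 : R].
  by split=> // [x z|x z] /= ->; [move=> ->; rewrite addr0 | rewrite mulr0].
have E0 : E `<=` [set 0].
  by apply: (local_nakayama hloc i0 iE) => z /hE; exact: ideal_addr.
have := regular_neq0 (regularM (@regularX _ _ j a_reg) (regularM a_reg b_reg)).
apply; apply: E0; apply: mem_ideal_mul; last exact: mem_ideal_mul.
by apply: mem_ideal_expX; exact: Im.
Qed.

(** The powers of m decrease, so one of the two ideals contains every power of m that the other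
    contains. *)
Lemma ulrich_total : total_on (ulrich_ideals m) (fun I J : set R => I `<=` J).
Proof.
move=> I J uI uJ.
have [h|] := pselect (forall j, mX j `<=` J -> mX j `<=` I).
  by right; exact: ulrich_sub.
move=> /existsNP[j /not_implyP[jJ njI]]; left; apply: ulrich_sub => // k kI.
apply: subset_trans jJ; apply: le_ideal_exp; case: leqP => // /ltnW kj.
by exfalso; apply: njI; apply: subset_trans kI; exact: le_ideal_exp.
Qed.

End UlrichIdeals.

(** * The equality m^2 = f m over R(X) from v(R) = e(R) *)

Section MinimalMultiplicity.
Variables (K : realType) (R : comNzRingType) (m : set R).
Hypothesis hloc : local_ring m.
Hypothesis hve : embdim K m = multiplicity K m.
Local Notation P := (poly_ideal m).
Let im : ideal m := ideal_max hloc.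
Let pP : prime_ideal P := prime_poly_ideal (prime_max hloc).
Local Notation mX n := (ideal_exp m n).
Let iX n : ideal (mX n) := ideal_ideal_exp m n.

(** Let e be the eventual length of m^n / m^(n+1), which is the multiplicity. Then m / m^2 has
    length at least v(R) = e. Over R(X), m / f m is at most as long as m^(N+1) / f m^(N+1), hence as
    e, so f m cannot be strictly smaller than m^2. *)
Lemma minimal_multiplicity_reduction (f : {poly R}) N0 :
  (forall i, m f`_i) -> (forall z, f * z = 0 -> z = 0) ->
  (forall N, (N0 <= N)%N ->
     poly_ideal (mX N.+1) `<=` dilate P f (poly_ideal (mX N))) ->
  poly_ideal (mX 2) `<=` dilate P f (poly_ideal (mX 1)).
Proof.
move=> fm f_reg fN.
have spX n := saturated_poly_ideal hloc (iX n).
have hX n : mX n.+1 `<=` mX n by exact: ideal_expS.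
have pX n k : (n <= k)%N -> poly_ideal (mX k) `<=` poly_ideal (mX n).
  by move=> nk; apply: poly_idealS; exact: le_ideal_exp.
have ex n : exists h, chain m (mX n.+1) (mX n) h /\ length_le m (mX n.+1) (mX n) h.
  have [c lc] := length_le_expS hloc n.
  have [h ch lh] := length_le_max (local_saturated hloc (iX n)) (@hX n) lc.
  by exists h.
have [h hh] := choice ex.
have ch n := (hh n).1; have lh n := (hh n).2.
have lP n : length_le P (poly_ideal (mX n.+1)) (poly_ideal (mX n)) (h n).
  by apply: (length_le_poly_ideal hloc).
have hS n : (N0 <= n)%N -> (h n.+1 <= h n)%N.
  move=> nN; apply: (lP n); apply: (pull_chain (spX n.+1) (spX n) _ _ (fN n nN))
    (chain_poly_ideal hloc (ch n.+1)); first exact: pX.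
  move=> z hz i; rewrite coefM; apply: (ideal_sum (iX _)) => j _.
  by apply: mem_ideal_mul; [exact: fm | exact: hz].
(* From N0 on, [h] does not increase, so it is constant once it reaches its least value. *)
have [N [e [N0N he]]] : exists N e,
    (N0 <= N)%N /\ forall n, (N <= n)%N -> h n = e.
  have exq : exists q, `[< exists2 n, (N0 <= n)%N & h n = q >].
    by exists (h N0); apply/asboolP; exists N0.
  case: (ex_minnP exq) => q /asboolP[N N0N hN] minq.
  exists N, q; split=> // n; elim: n => [|n IH].
    by rewrite leqn0 => /eqP N0'; rewrite -N0'.
  rewrite leq_eqVlt => /orP[/eqP<-//|]; rewrite ltnS => nN.
  apply/eqP; rewrite eqn_leq -{1}(IH nN) hS ?(leq_trans N0N)//=.
  apply: minq; apply/asboolP; exists n.+1 => //; apply: leq_trans N0N _.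
  exact: leqW.
have mult := multiplicityE K hloc ch lh he.
have [w [sw wm hw]] := length_le_gens hloc (iX 2) (iX 1) (@hX 1%N) (lh 1%N).
have em : m = ideal_gen [set` w].
  apply/seteqP; split; last first.
    apply: ideal_gen_sub => // x hx; rewrite -(ideal_exp1 im); exact: wm.
  have iw := ideal_ideal_gen [set` w].
  apply: (local_nakayama hloc iw im) => x mx.
  have iS := ideal_ideal_add iw (ideal_ideal_mul m m).
  have /hw : mX 1 x by exact: mem_ideal_exp1.
  apply: adjoins_sub => //.
    have -> : mX 2 = ideal_mul m m by rewrite -[X in ideal_mul m X](ideal_exp1 im).
    exact: ideal_addr.
  move=> z hz; apply: ideal_addl; first exact: ideal_ideal_mul.
  exact: mem_ideal_gen.
have eh1 : (e <= h 1%N)%N.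
  have := embdim_le K em; rewrite hve mult lee_fin ler_nat => h'.
  exact: leq_trans sw.
apply: contrapT => nsub.
have [c lc] := length_le_poly_exp hloc 1 N.
have NN1 : (N <= 1 + N)%N by rewrite leq_addl.
have lf : length_le P (dilate P f (poly_ideal (mX (1 + N))))
    (poly_ideal (mX (1 + N))) e.
  apply: (@length_leS _ P (poly_ideal (mX (1 + N).+1)) _
    (poly_ideal (mX (1 + N)))) => //.
    by apply: fN; apply: leq_trans NN1.
  by rewrite -(he _ NN1); exact: lP.
have lf1 := length_ge_dilate pP (spX _) (spX 1%N) (pX _ _ (leq_addr N 1)) f_reg lc lf.
have c1 := chain_poly_ideal hloc (ch 1%N).
have cD : chain P (dilate P f (poly_ideal (mX 1))) (poly_ideal (mX 2)) 1.
  have sD : saturated P (dilate P f (poly_ideal (mX 1))).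
    by apply: saturated_dilate => //; exact: ideal_poly_ideal.
  have D2 : dilate P f (poly_ideal (mX 1)) `<=` poly_ideal (mX 2).
    apply: saturation_sub => // _ [z hz <-] i; rewrite coefM.
    apply: (ideal_sum (iX 2)) => j _.
    by apply: mem_ideal_mul; [exact: fm | exact: hz].
  by apply: (@chain_rcons _ _ _ (dilate P f (poly_ideal (mX 1)))) => //; split.
by have := leq_trans (lf1 _ (chain_cat cD c1)) eh1; rewrite add1n ltnn.
Qed.

End MinimalMultiplicity.

Theorem theorem4p3 (K : realType) (R : comNzRingType) (m : set R)
    (hloc : local_ring m)
    (hCM : cohen_macaulay K m)
    (hdim : krull_dim K R = 1%:E)
    (hve : embdim K m = multiplicity K m)
    (hgt1 : (1%:E < embdim K m)%E) :
  total_on (ulrich_ideals m) (fun I J : set R => I `<=` J).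
Proof.
move=> I J uI uJ.
have d1 : depth K m = 1%:E by rewrite -hdim.
have [s ms s_reg] := depth_regular d1.
have [_ [a [prQ _ _ _ _]]] := uI.
have m_reg : exists2 s, m s & regular s by exists s.
have a_reg := parameter_regular m_reg prQ.
have ma : m a by apply: (primary_sub prQ); apply: sub_ideal_gen.
have [n hn] := primary_exp hloc prQ.
have im := ideal_max hloc.
have [w ew] := local_fg hloc im.
(* The ideal I supplies the parameter a, placed in degree 0; the generators of m follow. [Poly]
   drops trailing zeros, whence the default values below. *)
pose f := Poly (a :: w).
have f0 : f`_0 = a by rewrite coef_Poly.
have f_gen : m = ideal_gen [set` polyseq f].
  apply/seteqP; split.
    rewrite {1}ew; apply: ideal_gen_sub; first exact: ideal_ideal_gen.
    move=> x /(nthP 0)[i iw <-].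
    have -> : w`_i = f`_i.+1 by rewrite coef_Poly.
    have [lt|ge] := ltnP i.+1 (size f).
      by apply: mem_ideal_gen; exact: mem_nth.
    by rewrite nth_default//; apply: ideal0; exact: ideal_ideal_gen.
  apply: ideal_gen_sub => // x /(nthP 0)[i _ <-]; rewrite coef_Poly.
  have [lt|ge] := ltnP i (size (a :: w)); last first.
    by rewrite nth_default//; exact: ideal0.
  have := mem_nth 0 lt; rewrite inE => /orP[/eqP->//|h].
  by rewrite ew; exact: mem_ideal_gen.
have fm := coef_max hloc f_gen.
have f_reg := poly_reg a_reg f0.
have [N0 hN0] := reduction_poly hloc ma hn f_gen.
apply: (ulrich_total hloc fm f_reg) => //.
exact: (minimal_multiplicity_reduction hloc hve fm f_reg hN0).
Qed.
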